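(* Let $\phi:\mathbb{C}_0\to\mathbb{C}_0$ be a non-constant analytic function of the form $\phi(s)=c_0s+\varphi(s)$ with $c_0\in\mathbb{N}_0$, $\varphi\in\mathcal{D}$, such that $C_\phi f=f\circ\phi$ maps $\mathcal{A}^+$ into itself. Suppose moreover that $\phi$ has a continuous extension to $\overline{\mathbb{C}_0}=\{\operatorname{Re}s\ge0\}$ which preserves the boundary, i.e. $\phi(i\mathbb{R})\subseteq i\mathbb{R}$. Then $\phi(s)=c_0s+i\tau$ with $c_0\in\mathbb{N}_0$ and $\tau\in\mathbb{R}$.
   Context: $\mathbb{C}_0=\{\operatorname{Re}s>0\}$. $\mathcal{A}^+$ is the Banach algebra of Dirichlet series $f(s)=\sum_{n\ge1}a_nn^{-s}$ with $\|f\|_{\mathcal{A}^+}=\sum|a_n|<\infty$, viewed as functions on $\{\operatorname{Re}s\ge0\}$, with pointwise product. $\mathcal{D}$ is the space of analytic functions on $\mathbb{C}_0$ representable by a convergent Dirichlet series $\sum c_nn^{-s}$ for $\operatorname{Re}s$ large enough. $\mathbb{N}_0=\{0,1,2,\dots\}$. *)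

(* Defs.v *)
From Stdlib Require Import Reals.
From Coquelicot Require Import Coquelicot.
Open Scope R_scope.

(* n^{-s} = exp(-s log n) for a positive integer n, written out explicitly:
   n^{-s} = n^{-Re s} (cos(Im s log n) - i sin(Im s log n)). *)
Definition npow_neg (n : nat) (s : C) : C :=
  (exp (- Re s * ln (INR n)) * cos (Im s * ln (INR n)),
   - (exp (- Re s * ln (INR n)) * sin (Im s * ln (INR n)))).

(* The Dirichlet series  sum_{n>=1} a_n n^{-s}; the coefficient sequence is
   indexed so that a k is the coefficient of (k+1)^{-s}. *)
Definition dir_term (a : nat -> C) (s : C) (k : nat) : C :=
  Cmult (a k) (npow_neg (S k) s).

Definition abs_summable (a : nat -> C) : Prop :=
  ex_series (fun k => Cmod (a k)).

Definition C0 (s : C) : Prop := 0 < Re s.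

Definition holo_C0 (f : C -> C) : Prop :=
  forall s, C0 s -> @ex_derive C_AbsRing C_NormedModule f s.

Definition in_D (g : C -> C) : Prop :=
  holo_C0 g /\
  exists (c : nat -> C) (sigma0 : R),
    forall s, sigma0 < Re s -> is_series (dir_term c s) (g s).

Definition comp_maps_Aplus (phi : C -> C) : Prop :=
  forall a : nat -> C, abs_summable a ->
    exists b : nat -> C, abs_summable b /\
      forall s, C0 s ->
        exists v : C, is_series (dir_term a (phi s)) v /\ is_series (dir_term b s) v.

Definition C0bar (s : C) : Prop := 0 <= Re s.

(* Main.v *)
Require Import Defs.
From Stdlib Require Import Reals.
From Coquelicot Require Import Coquelicot.
From Stdlib Require Import Lra Lia ClassicalEpsilon.
Open Scope R_scope.

(** Re phi is a positive harmonic function on the half-plane with zero boundary values, so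
    it must be a multiple of Re s. For Re s large, varphi is bounded. Where Re s is small,
    a Harnack-type inequality gives Re phi = O(1 / Re s), so g = phi - c0 s satisfies
    |Re g| <= M + K / Re s on the half-plane while Re g = 0 on the imaginary axis. A
    Phragmen-Lindelof argument then yields Re g = 0, hence g is an imaginary constant.

    Both estimates rest on the weak maximum principle for real parts of functions that are
    merely complex differentiable. *)

(** * Goursat's lemma on boxes *)

(** The obstacle is the strip next to the imaginary axis at large height: the Dirichlet series
    controls [varphi] only far to the right, while Phragmen-Lindelof needs a growth bound
    everywhere. Positivity of Re phi is what carries the control across the strip, and the factor 1
    / Re s is its price. It is needed for the upper bound only: on the strip Re phi > 0 already
    gives Re g > - c0 sigma, where sigma is the abscissa from which [varphi] is bounded. The factor
    1 / Re s does harm only where the horizontal sides of a large box meet the axis, and continuity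
    up to the boundary settles those corners. The second derivative test behind the maximum
    principle needs one more derivative than complex differentiability offers; Goursat's lemma
    supplies it by producing a primitive. *)

Lemma nested_intervals (a b : nat -> R) :
  (forall n, a n <= a (S n)) -> (forall n, b (S n) <= b n) ->
  (forall n, a n <= b n) -> exists x, forall n, a n <= x <= b n.
Proof.
intros Ha Hb Hab.
assert (Ham : forall n m, (n <= m)%nat -> a n <= a m).
{ intros n m H; induction H; [lra|]. specialize (Ha m); lra. }
assert (Hbm : forall n m, (n <= m)%nat -> b m <= b n).
{ intros n m H; induction H; [lra|]. specialize (Hb m); lra. }
assert (Hc : forall n m, a n <= b m).
{ intros n m. specialize (Ham n (max n m) ltac:(lia)).
  specialize (Hbm m (max n m) ltac:(lia)). specialize (Hab (max n m)). lra. }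
destruct (ex_finite_lim_seq_incr a (b O) Ha (fun n => Hc n O)) as [x Hx].
exists x; intros n; split.
- apply (is_lim_seq_incr_compare a x Hx Ha n).
- apply (is_lim_seq_le a (fun _ => b n) x (b n)); auto.
  apply is_lim_seq_const.
Qed.

(** A box where [P] fails has a quarter where it fails; the failing boxes shrink to a point, against
    the local hypothesis there. This bisection serves both the existence of maxima and Goursat's
    lemma. *)
Lemma box_induction (P : R -> R -> R -> R -> Prop) (a b c d : R) :
  a <= b -> c <= d ->
  (forall a b c d, a <= b -> c <= d ->
     P a ((a + b) / 2) c ((c + d) / 2) -> P ((a + b) / 2) b c ((c + d) / 2) ->
     P a ((a + b) / 2) ((c + d) / 2) d -> P ((a + b) / 2) b ((c + d) / 2) d ->
     P a b c d) ->
  (forall x y, a <= x <= b -> c <= y <= d -> exists delta, 0 < delta /\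
     forall a' b' c' d', a <= a' <= x -> x <= b' <= b -> c <= c' <= y -> y <= d' <= d ->
       b' - a' < delta -> d' - c' < delta -> P a' b' c' d') ->
  P a b c d.
Proof.
intros Hab Hcd Hsub Hloc. apply NNPP; intros HN.
pose (Inv := fun q : (R * R) * (R * R) =>
  fst (fst q) <= snd (fst q) /\ fst (snd q) <= snd (snd q) /\
  ~ P (fst (fst q)) (snd (fst q)) (fst (snd q)) (snd (snd q))).
(* [Inv q] stands under the existential so that choice yields a total [step]; when all four quarters
   satisfy [P], the box itself is a dummy witness. *)
assert (Hstep : forall q, exists q', Inv q -> Inv q' /\
  (fst (fst q) <= fst (fst q') /\ snd (fst q') <= snd (fst q) /\
   fst (snd q) <= fst (snd q') /\ snd (snd q') <= snd (snd q)) /\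
  snd (fst q') - fst (fst q') = (snd (fst q) - fst (fst q)) / 2 /\
  snd (snd q') - fst (snd q') = (snd (snd q) - fst (snd q)) / 2).
{ intros [[a0 b0] [c0 d0]]. unfold Inv; simpl.
  set (m := (a0 + b0) / 2). set (n := (c0 + d0) / 2).
  destruct (classic (P a0 m c0 n)) as [H1|H1];
    [|exists ((a0, m), (c0, n)); simpl; unfold m, n in *; intuition lra].
  destruct (classic (P m b0 c0 n)) as [H2|H2];
    [|exists ((m, b0), (c0, n)); simpl; unfold m, n in *; intuition lra].
  destruct (classic (P a0 m n d0)) as [H3|H3];
    [|exists ((a0, m), (n, d0)); simpl; unfold m, n in *; intuition lra].
  destruct (classic (P m b0 n d0)) as [H4|H4];
    [|exists ((m, b0), (n, d0)); simpl; unfold m, n in *; intuition lra].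
  exists ((a0, b0), (c0, d0)). intros (K1 & K2 & K3). exfalso; apply K3; auto. }
pose (step := fun q => proj1_sig (constructive_indefinite_description _ (Hstep q))).
assert (Hst : forall q, Inv q -> Inv (step q) /\
  (fst (fst q) <= fst (fst (step q)) /\ snd (fst (step q)) <= snd (fst q) /\
   fst (snd q) <= fst (snd (step q)) /\ snd (snd (step q)) <= snd (snd q)) /\
  snd (fst (step q)) - fst (fst (step q)) = (snd (fst q) - fst (fst q)) / 2 /\
  snd (snd (step q)) - fst (snd (step q)) = (snd (snd q) - fst (snd q)) / 2).
{ intros q. unfold step. destruct (constructive_indefinite_description _ (Hstep q)); auto. }
clearbody step.
pose (X := fix X n := match n with O => ((a, b), (c, d)) | S n => step (X n) end).
assert (HI : forall n, Inv (X n)).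
{ induction n; [unfold Inv; simpl; auto|]. simpl. apply Hst, IHn. }
assert (Hsize : forall n, snd (fst (X n)) - fst (fst (X n)) = (b - a) / 2 ^ n /\
   snd (snd (X n)) - fst (snd (X n)) = (d - c) / 2 ^ n).
{ induction n; [simpl; lra|]. destruct (Hst _ (HI n)) as (_ & _ & E1 & E2).
  destruct IHn as [I1 I2]. change (X (S n)) with (step (X n)).
  rewrite E1, E2, I1, I2. assert (2 ^ n <> 0) by (apply pow_nonzero; lra).
  simpl; split; field; auto. }
assert (Hmono : forall n, fst (fst (X n)) <= fst (fst (X (S n))) /\
   snd (fst (X (S n))) <= snd (fst (X n)) /\
   fst (snd (X n)) <= fst (snd (X (S n))) /\ snd (snd (X (S n))) <= snd (snd (X n))).
{ intros n; apply (Hst _ (HI n)). }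
destruct (nested_intervals (fun n => fst (fst (X n))) (fun n => snd (fst (X n)))) as [x Hx];
  try (intros n; try apply Hmono; apply (HI n)).
destruct (nested_intervals (fun n => fst (snd (X n))) (fun n => snd (snd (X n)))) as [y Hy];
  try (intros n; try apply Hmono; apply (HI n)).
destruct (Hloc x y (Hx O) (Hy O)) as (delta & Hd & HP).
assert (Hbd : forall n, a <= fst (fst (X n)) /\ snd (fst (X n)) <= b /\
   c <= fst (snd (X n)) /\ snd (snd (X n)) <= d).
{ induction n; [simpl; lra|]. specialize (Hmono n). lra. }
assert (Hlim : is_lim_seq (fun n => ((b - a) + (d - c)) * (/ 2) ^ n) 0).
{ replace (Finite 0) with (Rbar_mult ((b - a) + (d - c)) 0) by (simpl; f_equal; ring).
  apply is_lim_seq_scal_l. apply is_lim_seq_geom. rewrite Rabs_pos_eq; lra. }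
apply is_lim_seq_spec in Hlim. destruct (Hlim (mkposreal _ Hd)) as [N HNn].
specialize (HNn N (le_n N)). simpl in HNn. rewrite Rminus_0_r in HNn.
apply Rabs_def2 in HNn. destruct HNn as [HNn _].
assert (Hp : 0 < (/ 2) ^ N) by (apply pow_lt; lra).
destruct (Hsize N) as [S1 S2]. unfold Rdiv in S1, S2. rewrite <- pow_inv in S1, S2.
destruct (HI N) as (_ & _ & HNP). apply HNP.
specialize (Hbd N). specialize (Hx N). specialize (Hy N). simpl in Hx, Hy.
apply HP; try lra; nra.
Qed.

(** Only upper semicontinuity is assumed. Without a maximum, each point is beaten by some higher
    value, which by semicontinuity beats a whole neighbourhood; bisection then gives one value of
    [g] beating the entire box, its own point included. *)
Lemma box_max (g : R -> R -> R) (a b c d : R) :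
  a <= b -> c <= d ->
  (forall x y, a <= x <= b -> c <= y <= d -> forall eps, 0 < eps ->
     exists delta, 0 < delta /\ forall x' y', a <= x' <= b -> c <= y' <= d ->
       Rabs (x' - x) < delta -> Rabs (y' - y) < delta -> g x' y' < g x y + eps) ->
  exists x y, a <= x <= b /\ c <= y <= d /\
    forall x' y', a <= x' <= b -> c <= y' <= d -> g x' y' <= g x y.
Proof.
intros Hab Hcd Hcont. apply NNPP; intros HN.
assert (Hbig : forall x y, a <= x <= b -> c <= y <= d ->
  exists p q, a <= p <= b /\ c <= q <= d /\ g x y < g p q).
{ intros x y Hx Hy. apply NNPP; intros H. apply HN. exists x, y.
  repeat split; try tauto. intros x' y' Hx' Hy'. apply Rnot_lt_le. intros H'.
  apply H. exists x', y'; auto. }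
pose (P := fun a' b' c' d' => a <= a' -> b' <= b -> c <= c' -> d' <= d ->
  exists p q, a <= p <= b /\ c <= q <= d /\
    forall x y, a' <= x <= b' -> c' <= y <= d' -> g x y < g p q).
assert (H : P a b c d).
{ apply box_induction; auto.
  - intros a0 b0 c0 d0 Hab0 Hcd0 H1 H2 H3 H4 K1 K2 K3 K4.
    destruct H1 as (p1 & q1 & P1 & Q1 & H1); try lra.
    destruct H2 as (p2 & q2 & P2 & Q2 & H2); try lra.
    destruct H3 as (p3 & q3 & P3 & Q3 & H3); try lra.
    destruct H4 as (p4 & q4 & P4 & Q4 & H4); try lra.
    assert (HM : exists p q, a <= p <= b /\ c <= q <= d /\
      g p1 q1 <= g p q /\ g p2 q2 <= g p q /\ g p3 q3 <= g p q /\ g p4 q4 <= g p q).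
    { destruct (Rle_dec (g p1 q1) (g p2 q2)), (Rle_dec (g p3 q3) (g p4 q4)).
      - destruct (Rle_dec (g p2 q2) (g p4 q4));
          [exists p4, q4|exists p2, q2]; repeat split; lra.
      - destruct (Rle_dec (g p2 q2) (g p3 q3));
          [exists p3, q3|exists p2, q2]; repeat split; lra.
      - destruct (Rle_dec (g p1 q1) (g p4 q4));
          [exists p4, q4|exists p1, q1]; repeat split; lra.
      - destruct (Rle_dec (g p1 q1) (g p3 q3));
          [exists p3, q3|exists p1, q1]; repeat split; lra. }
    destruct HM as (p & q & Hp & Hq & M1 & M2 & M3 & M4).
    exists p, q; repeat split; try lra. intros x y Hx Hy.
    destruct (Rle_dec x ((a0 + b0) / 2)), (Rle_dec y ((c0 + d0) / 2)).
    + specialize (H1 x y); lra.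
    + specialize (H3 x y); lra.
    + specialize (H2 x y); lra.
    + specialize (H4 x y); lra.
  - intros x y Hx Hy. destruct (Hbig x y Hx Hy) as (p & q & Hp & Hq & Hlt).
    destruct (Hcont x y Hx Hy (g p q - g x y)) as (delta & Hd & HC); [lra|].
    exists delta; split; auto. intros a' b' c' d' A1 A2 A3 A4 A5 A6 _ _ _ _.
    exists p, q; repeat split; try lra. intros x' y' Hx' Hy'.
    specialize (HC x' y' ltac:(lra) ltac:(lra)).
    assert (Rabs (x' - x) < delta) by (apply Rabs_def1; lra).
    assert (Rabs (y' - y) < delta) by (apply Rabs_def1; lra).
    specialize (HC H H0). lra. }
destruct H as (p & q & Hp & Hq & H); try lra.
specialize (H p q Hp Hq). lra.
Qed.

(** Counterclockwise boundary integral of the 1-form P dx + Q dy. *)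
Definition circulation (P Q : R -> R -> R) (a b c d : R) : R :=
  RInt (fun x => P x c) a b + RInt (fun y => Q b y) c d
  - RInt (fun x => P x d) a b - RInt (fun y => Q a y) c d.

(** The affine part is integrated exactly, so only the remainder costs anything; in Goursat's
    argument it is the first-order expansion along a side. *)
Lemma RInt_near_affine (f : R -> R) (a b k p M : R) :
  a <= b -> ex_RInt f a b ->
  (forall x, a <= x <= b -> Rabs (f x - (k + p * x)) <= M) ->
  Rabs (RInt f a b - ((b - a) * k + p * (b ^ 2 - a ^ 2) / 2)) <= (b - a) * M.
Proof.
intros Hab Hf HM.
assert (Haff : is_RInt (fun x => k + p * x) a b ((b - a) * k + p * (b ^ 2 - a ^ 2) / 2)).
{ replace ((b - a) * k + p * (b ^ 2 - a ^ 2) / 2)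
    with (minus (b * k + p * b ^ 2 / 2) (a * k + p * a ^ 2 / 2))
    by (unfold minus, plus, opp; simpl; field).
  apply (is_RInt_derive (fun x => x * k + p * x ^ 2 / 2)).
  - intros x _. auto_derive; auto. field.
  - intros x _. apply (ex_derive_continuous (V := R_NormedModule)). auto_derive; auto. }
apply (norm_RInt_le_const (V := R_NormedModule)
  (fun x => minus (f x) (k + p * x)) a b _ M Hab).
- intros x Hx. apply HM, Hx.
- apply @is_RInt_minus; auto. apply (RInt_correct (V := R_CompleteNormedModule)), Hf.
Qed.

(** The shared [q] encodes dP/dy = dQ/dx at the point, with no continuity of the partial
    derivatives. *)
Definition closed_form_at (P Q : R -> R -> R) (x y : R) : Prop :=
  exists p q r, differentiable_pt_lim P x y p q /\ differentiable_pt_lim Q x y q r.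

Lemma differentiable_derive_l (P : R -> R -> R) x y p q :
  differentiable_pt_lim P x y p q -> is_derive (fun z => P z y) x p.
Proof.
intros H. replace p with (p * 1 + q * 0) by ring. apply is_derive_Reals.
apply (derivable_pt_lim_comp_2d P (fun z => z) (fun _ => y)); auto.
- apply derivable_pt_lim_id.
- apply derivable_pt_lim_const.
Qed.

Lemma differentiable_derive_r (P : R -> R -> R) x y p q :
  differentiable_pt_lim P x y p q -> is_derive (fun z => P x z) y q.
Proof.
intros H. replace q with (p * 0 + q * 1) by ring. apply is_derive_Reals.
apply (derivable_pt_lim_comp_2d P (fun _ => x) (fun z => z)); auto.
- apply derivable_pt_lim_const.
- apply derivable_pt_lim_id.
Qed.

Lemma closed_form_continuous (P Q : R -> R -> R) x y : closed_form_at P Q x y ->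
  continuous (fun z => P z y) x /\ continuous (fun z => Q x z) y.
Proof.
intros (p & q & r & HP & HQ). split.
- apply @ex_derive_continuous. exists p. apply differentiable_derive_l with (1 := HP).
- apply @ex_derive_continuous. exists r. apply differentiable_derive_r with (1 := HQ).
Qed.

Lemma closed_form_integrable (P Q : R -> R -> R) a b c d : a <= b -> c <= d ->
  (forall x y, a <= x <= b -> c <= y <= d -> closed_form_at P Q x y) ->
  forall a' b' c' d', a <= a' <= b' -> b' <= b -> c <= c' <= d' -> d' <= d ->
  (forall y, c <= y <= d -> ex_RInt (fun x => P x y) a' b') /\
  (forall x, a <= x <= b -> ex_RInt (fun y => Q x y) c' d').
Proof.
intros Hab Hcd H a' b' c' d' H1 H2 H3 H4; split.
- intros y Hy. apply (ex_RInt_continuous (V := R_CompleteNormedModule)). intros z Hz.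
  rewrite Rmin_left, Rmax_right in Hz by lra.
  apply (closed_form_continuous P Q z y). apply H; lra.
- intros x Hx. apply (ex_RInt_continuous (V := R_CompleteNormedModule)). intros z Hz.
  rewrite Rmin_left, Rmax_right in Hz by lra.
  apply (closed_form_continuous P Q x z). apply H; lra.
Qed.

Lemma circulation_split (P Q : R -> R -> R) a m b c n d :
  a <= m <= b -> c <= n <= d ->
  (forall x y, a <= x <= b -> c <= y <= d -> closed_form_at P Q x y) ->
  circulation P Q a b c d =
    circulation P Q a m c n + circulation P Q m b c n
    + circulation P Q a m n d + circulation P Q m b n d.
Proof.
intros Hm Hn H. assert (HI := closed_form_integrable P Q a b c d ltac:(lra) ltac:(lra) H).
assert (HP : forall y, c <= y <= d ->
  RInt (fun x => P x y) a b = RInt (fun x => P x y) a m + RInt (fun x => P x y) m b).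
{ intros y Hy. symmetry. apply (RInt_Chasles (V := R_CompleteNormedModule)).
  - apply (HI a m c d); lra.
  - apply (HI m b c d); lra. }
assert (HQ : forall x, a <= x <= b ->
  RInt (fun y => Q x y) c d = RInt (fun y => Q x y) c n + RInt (fun y => Q x y) n d).
{ intros x Hx. symmetry. apply (RInt_Chasles (V := R_CompleteNormedModule)).
  - apply (HI a b c n); lra.
  - apply (HI a b n d); lra. }
unfold circulation. rewrite (HP c), (HP d), (HQ a), (HQ b) by lra. ring.
Qed.

(* Goursat's argument: the bound 4 eps (width + height)^2 adds up exactly
   under bisection of both sides, so no shape condition on the boxes is needed. *)
Lemma goursat_box (P Q : R -> R -> R) a b c d : a <= b -> c <= d ->
  (forall x y, a <= x <= b -> c <= y <= d -> closed_form_at P Q x y) ->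
  circulation P Q a b c d = 0.
Proof.
intros Hab Hcd H.
assert (Hbound : forall eps : posreal,
  Rabs (circulation P Q a b c d) <= 4 * eps * ((b - a) + (d - c)) ^ 2).
{ intros eps.
  pose (S := fun a' b' c' d' => a <= a' -> b' <= b -> c <= c' -> d' <= d ->
    Rabs (circulation P Q a' b' c' d') <= 4 * eps * ((b' - a') + (d' - c')) ^ 2).
  assert (HS : S a b c d).
  { apply box_induction; auto; unfold S.
    - intros a0 b0 c0 d0 Hab0 Hcd0 H1 H2 H3 H4 K1 K2 K3 K4.
      rewrite (circulation_split P Q a0 ((a0 + b0) / 2) b0 c0 ((c0 + d0) / 2) d0);
        try lra; [|intros; apply H; lra].
      specialize (H1 ltac:(lra) ltac:(lra) ltac:(lra) ltac:(lra)).
      specialize (H2 ltac:(lra) ltac:(lra) ltac:(lra) ltac:(lra)).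
      specialize (H3 ltac:(lra) ltac:(lra) ltac:(lra) ltac:(lra)).
      specialize (H4 ltac:(lra) ltac:(lra) ltac:(lra) ltac:(lra)).
      apply Rabs_le_between in H1. apply Rabs_le_between in H2.
      apply Rabs_le_between in H3. apply Rabs_le_between in H4.
      apply Rabs_le_between.
      replace (((a0 + b0) / 2 - a0) + ((c0 + d0) / 2 - c0))
        with (((b0 - a0) + (d0 - c0)) / 2) in H1 by field.
      replace ((b0 - (a0 + b0) / 2) + ((c0 + d0) / 2 - c0))
        with (((b0 - a0) + (d0 - c0)) / 2) in H2 by field.
      replace (((a0 + b0) / 2 - a0) + (d0 - (c0 + d0) / 2))
        with (((b0 - a0) + (d0 - c0)) / 2) in H3 by field.
      replace ((b0 - (a0 + b0) / 2) + (d0 - (c0 + d0) / 2))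
        with (((b0 - a0) + (d0 - c0)) / 2) in H4 by field.
      set (w := (b0 - a0) + (d0 - c0)) in *.
      replace (4 * eps * w ^ 2) with (4 * (4 * eps * (w / 2) ^ 2)) by field.
      lra.
    - intros x y Hx Hy. destruct (H x y Hx Hy) as (p & q & r & HP & HQ).
      destruct (HP eps) as [d1 H1]. destruct (HQ eps) as [d2 H2].
      exists (Rmin d1 d2). split; [apply Rmin_pos; apply cond_pos|].
      intros a' b' c' d' Ha' Hb' Hc' Hd' Hw Hh _ _ _ _.
      assert (Hw1 := Rmin_l d1 d2). assert (Hw2 := Rmin_r d1 d2).
      assert (HI := closed_form_integrable P Q a b c d ltac:(lra) ltac:(lra) H a' b' c' d'
        ltac:(lra) ltac:(lra) ltac:(lra) ltac:(lra)).
      set (w := b' - a') in *. set (h := d' - c') in *.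
      assert (HPb : forall u v, a' <= u <= b' -> c' <= v <= d' ->
        Rabs (P u v - (P x y - p * x + q * (v - y) + p * u)) <= eps * (w + h) /\
        Rabs (Q u v - (Q x y - r * y + q * (u - x) + r * v)) <= eps * (w + h)).
      { intros u v Hu Hv.
        assert (Hux : Rabs (u - x) <= w) by (apply Rabs_le_between; unfold w; lra).
        assert (Hvy : Rabs (v - y) <= h) by (apply Rabs_le_between; unfold h; lra).
        assert (Hmax : Rmax (Rabs (u - x)) (Rabs (v - y)) <= w + h).
        { assert (0 <= Rabs (u - x)) by apply Rabs_pos.
          assert (0 <= Rabs (v - y)) by apply Rabs_pos. apply Rmax_lub; lra. }
        apply (Rmult_le_compat_l eps) in Hmax; [|apply Rlt_le, cond_pos].
        specialize (H1 u v ltac:(lra) ltac:(lra)). specialize (H2 u v ltac:(lra) ltac:(lra)).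
        split.
        - replace (P u v - (P x y - p * x + q * (v - y) + p * u))
            with (P u v - P x y - (p * (u - x) + q * (v - y))) by ring. lra.
        - replace (Q u v - (Q x y - r * y + q * (u - x) + r * v))
            with (Q u v - Q x y - (q * (u - x) + r * (v - y))) by ring. lra. }
      assert (E1 := RInt_near_affine (fun u => P u c') a' b' (P x y - p * x + q * (c' - y)) p
        (eps * (w + h)) ltac:(lra) (proj1 HI c' ltac:(lra))
        (fun u Hu => proj1 (HPb u c' Hu ltac:(lra)))).
      assert (E2 := RInt_near_affine (fun u => P u d') a' b' (P x y - p * x + q * (d' - y)) p
        (eps * (w + h)) ltac:(lra) (proj1 HI d' ltac:(lra))
        (fun u Hu => proj1 (HPb u d' Hu ltac:(lra)))).
      assert (E3 := RInt_near_affine (fun v => Q a' v) c' d' (Q x y - r * y + q * (a' - x)) r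
        (eps * (w + h)) ltac:(lra) (proj2 HI a' ltac:(lra))
        (fun v Hv => proj2 (HPb a' v ltac:(lra) Hv))).
      assert (E4 := RInt_near_affine (fun v => Q b' v) c' d' (Q x y - r * y + q * (b' - x)) r
        (eps * (w + h)) ltac:(lra) (proj2 HI b' ltac:(lra))
        (fun v Hv => proj2 (HPb b' v ltac:(lra) Hv))).
      fold w in E1, E2. fold h in E3, E4.
      apply Rabs_le_between in E1. apply Rabs_le_between in E2.
      apply Rabs_le_between in E3. apply Rabs_le_between in E4.
      (* All other affine terms cancel between opposite sides; the mixed ones cancel because [q] is
         shared. The four remainders total 2 eps (w + h)^2, within the claimed bound. *)
      assert (Hcancel : w * (q * (c' - d')) + h * (q * (b' - a')) = 0) by (unfold w, h; ring).
      assert (Heps : 0 <= eps * (w + h) * (w + h)).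
      { assert (He := cond_pos eps).
        assert (0 <= w) by (unfold w; lra). assert (0 <= h) by (unfold h; lra).
        apply Rmult_le_pos; [apply Rmult_le_pos|]; lra. }
      unfold circulation. apply Rabs_le_between. lra. }
  unfold S in HS. apply HS; lra. }
destruct (Req_dec (circulation P Q a b c d) 0) as [E|E]; auto. exfalso.
apply Rabs_pos_lt in E. set (J := Rabs (circulation P Q a b c d)) in *.
set (w := (b - a) + (d - c)) in *.
assert (Hw : 0 <= w ^ 2) by apply pow2_ge_0.
(* With this eps the bound becomes J w^2 / (w^2 + 1), which is below J; the added 1 covers w = 0. *)
assert (Hpos : 0 < J / (4 * (w ^ 2 + 1))) by (apply Rdiv_lt_0_compat; lra).
specialize (Hbound (mkposreal _ Hpos)).
change (J <= 4 * (J / (4 * (w ^ 2 + 1))) * w ^ 2) in Hbound.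
replace (4 * (J / (4 * (w ^ 2 + 1))) * w ^ 2)
  with (J - J / (w ^ 2 + 1)) in Hbound by (field; lra).
assert (0 < J / (w ^ 2 + 1)) by (apply Rdiv_lt_0_compat; lra). lra.
Qed.

(** The potential integrates the form along the bottom edge and then upwards, which shows its
    y-derivative. By Goursat it equals the integral up the left edge and then across, which shows
    its x-derivative. *)
Lemma closed_form_potential (P Q : R -> R -> R) a b c d : a < b -> c < d ->
  (forall x y, a <= x <= b -> c <= y <= d -> closed_form_at P Q x y) ->
  exists U, forall x y, a < x < b -> c < y < d ->
    is_derive (fun z => U z y) x (P x y) /\ is_derive (fun z => U x z) y (Q x y).
Proof.
intros Hab Hcd H.
exists (fun x y => RInt (fun t => P t c) a x + RInt (fun t => Q x t) c y).
assert (HI := closed_form_integrable P Q a b c d ltac:(lra) ltac:(lra) H).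
assert (HG : forall x y, a < x < b -> c < y < d ->
  RInt (fun t => P t c) a x + RInt (fun t => Q x t) c y =
  RInt (fun t => Q a t) c y + RInt (fun t => P t y) a x).
{ intros x y Hx Hy. assert (G := goursat_box P Q a x c y ltac:(lra) ltac:(lra)
    ltac:(intros; apply H; lra)). unfold circulation in G. lra. }
assert (Hopen : forall l u z (S : R -> Prop), l < z < u -> (forall t, l < t < u -> S t) -> locally z S).
{ intros l u z S Hz HS.
  assert (Hp : 0 < Rmin (z - l) (u - z)) by (apply Rmin_pos; lra).
  exists (mkposreal _ Hp). intros t Ht. apply Rabs_def2 in Ht. simpl in Ht.
  assert (A1 := Rmin_l (z - l) (u - z)). assert (A2 := Rmin_r (z - l) (u - z)).
  unfold minus, plus, opp in Ht; simpl in Ht. apply HS; lra. }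
intros x y Hx Hy. split.
- apply is_derive_ext_loc with
    (fun z => plus (RInt (fun t => Q a t) c y) (RInt (fun t => P t y) a z)).
  + apply (Hopen a b); auto. intros t Ht. symmetry. apply HG; auto.
  + replace (P x y) with (plus 0 (P x y)) by apply Rplus_0_l.
    apply @is_derive_plus; [apply @is_derive_const|].
    apply (is_derive_RInt (fun t => P t y) _ a).
    * apply (Hopen a b); auto. intros t Ht.
      apply (RInt_correct (V := R_CompleteNormedModule)). apply (HI a t c d); lra.
    * apply (closed_form_continuous P Q x y). apply H; lra.
- replace (Q x y) with (plus 0 (Q x y)) by apply Rplus_0_l.
  apply @is_derive_plus; [apply @is_derive_const|].
  apply (is_derive_RInt (fun t => Q x t) _ c).
  + apply (Hopen c d); auto. intros t Ht.
    apply (RInt_correct (V := R_CompleteNormedModule)). apply (HI a b c t); lra.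
  + apply (closed_form_continuous P Q x y). apply H; lra.
Qed.

(** * The maximum principle *)

(** If [A] were positive, g', which vanishes at x, would be positive just to the right of x, and the
    mean value theorem would push [g] above its maximum. *)
Lemma second_derivative_nonpos_at_max (g g' : R -> R) (x A r : R) :
  0 < r -> (forall t, Rabs (t - x) < r -> is_derive g t (g' t)) ->
  is_derive g' x A -> (forall t, Rabs (t - x) < r -> g t <= g x) -> A <= 0.
Proof.
intros Hr Hg HA Hmax. apply Rnot_lt_le. intros HApos.
assert (Hin : forall t, x - r < t < x + r -> Rabs (t - x) < r)
  by (intros; apply Rabs_def1; lra).
assert (Hg0 : g' x = 0).
{ assert (Hx := Hg x (Hin x ltac:(lra))).
  assert (pr : derivable_pt g x) by (exists (g' x); apply is_derive_Reals; auto).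
  assert (E : derive_pt g x pr = 0).
  { apply (deriv_maximum g (x - r) (x + r)); try lra. intros; apply Hmax, Hin; lra. }
  rewrite <- E, Derive_Reals. symmetry. apply is_derive_unique, Hx. }
apply is_derive_Reals in HA. destruct (HA A HApos) as [d Hd].
set (e := Rmin d r / 2).
assert (He : 0 < e < d /\ e < r).
{ assert (H1 := Rmin_l d r). assert (H2 := Rmin_r d r).
  assert (0 < Rmin d r) by (apply Rmin_pos; [apply cond_pos|auto]). unfold e; lra. }
destruct (MVT_cor2 g g' x (x + e)) as (z & Hz & Hzi); try lra.
{ intros z Hz. apply is_derive_Reals, Hg, Hin; lra. }
specialize (Hd (z - x) ltac:(lra) ltac:(apply Rabs_def1; lra)).
replace (x + (z - x)) with z in Hd by ring. rewrite Hg0 in Hd.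
apply Rabs_def2 in Hd. destruct Hd as [_ Hd].
assert (0 < (g' z - 0) / (z - x)) by lra.
assert (0 < g' z).
{ replace (g' z) with ((g' z - 0) / (z - x) * (z - x)) by (field; lra).
  apply Rmult_lt_0_compat; lra. }
assert (0 < g' z * (x + e - x)) by (apply Rmult_lt_0_compat; lra).
specialize (Hmax (x + e) (Hin (x + e) ltac:(lra))). lra.
Qed.

Definition cauchy_riemann_at (u v : R -> R -> R) (x y : R) : Prop :=
  exists p q, differentiable_pt_lim u x y p (- q) /\ differentiable_pt_lim v x y q p.

Lemma continuity_2d_pt_usc (g : R -> R -> R) x y : continuity_2d_pt g x y ->
  forall eps, 0 < eps -> exists delta, 0 < delta /\ forall x' y',
    Rabs (x' - x) < delta -> Rabs (y' - y) < delta -> g x' y' < g x y + eps.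
Proof.
intros H eps He. destruct (H (mkposreal _ He)) as [d Hd].
exists d; split; [apply cond_pos|]. intros x' y' Hx Hy.
specialize (Hd x' y' Hx Hy). apply Rabs_def2 in Hd. simpl in Hd. lra.
Qed.

Lemma locally_2d_open_box a b c d x y (S : R -> R -> Prop) :
  a < x < b -> c < y < d -> (forall x y, a < x < b -> c < y < d -> S x y) ->
  locally_2d S x y.
Proof.
intros Hx Hy HS.
assert (H1 : 0 < Rmin (x - a) (b - x)) by (apply Rmin_pos; lra).
assert (H2 : 0 < Rmin (y - c) (d - y)) by (apply Rmin_pos; lra).
assert (H3 : 0 < Rmin (Rmin (x - a) (b - x)) (Rmin (y - c) (d - y))) by (apply Rmin_pos; lra).
exists (mkposreal _ H3). simpl. intros x' y' Hx' Hy'.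
assert (M1 := Rmin_l (x - a) (b - x)). assert (M2 := Rmin_r (x - a) (b - x)).
assert (M3 := Rmin_l (y - c) (d - y)). assert (M4 := Rmin_r (y - c) (d - y)).
assert (M5 := Rmin_l (Rmin (x - a) (b - x)) (Rmin (y - c) (d - y))).
assert (M6 := Rmin_r (Rmin (x - a) (b - x)) (Rmin (y - c) (d - y))).
apply Rabs_def2 in Hx'. apply Rabs_def2 in Hy'. apply HS; lra.
Qed.

(* A holomorphic function f = u + iv is not assumed to be twice differentiable, so the
   second derivative test is applied to the real part of (F(s + h) - F(s)) / h, where F
   is a primitive of f: its value is a value of u at a nearby point. *)
Lemma real_part_no_strict_max (u v : R -> R -> R) (px py r eps : R) :
  0 < r -> 0 < eps ->
  (forall x y, px - r <= x <= px + r -> py - r <= y <= py + r -> cauchy_riemann_at u v x y) ->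
  (forall x y, px - r <= x <= px + r -> py - r <= y <= py + r ->
     u x y <= u px py - eps * ((x - px) ^ 2 + (y - py) ^ 2)) ->
  False.
Proof.
intros Hr He Hcr Hmax.
(* By Cauchy-Riemann u dx - v dy is closed; its potential [U] is the real part of a primitive of u +
   iv. *)
destruct (closed_form_potential u (fun x y => - v x y) (px - r) (px + r) (py - r) (py + r))
  as [U HU]; try lra.
{ intros x y Hx Hy. destruct (Hcr x y Hx Hy) as (p & q & Hu & Hv).
  exists p, (- q), (- p). split; auto.
  apply filterdiff_differentiable_pt_lim. apply filterdiff_differentiable_pt_lim in Hv.
  apply filterdiff_ext_lin with (fun z : R * R => opp (fst z * q + snd z * p)).
  - apply @filterdiff_opp_fct; auto. apply locally_filter.
  - intros z. unfold opp; simpl. ring. }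
assert (HUc : forall x y, px - r < x < px + r -> py - r < y < py + r -> continuity_2d_pt U x y).
{ intros x y Hx Hy. apply differentiable_continuity_pt.
  exists (u x y), (- v x y).
  apply filterdiff_differentiable_pt_lim.
  apply (is_derive_filterdiff U x y u (- v x y)).
  - apply -> (locally_2d_locally (fun s t => is_derive (fun z => U z t) s (u s t))).
    apply (locally_2d_open_box (px - r) (px + r) (py - r) (py + r)); auto.
    intros x' y' Hx' Hy'. apply HU; auto.
  - apply HU; auto.
  - destruct (Hcr x y ltac:(lra) ltac:(lra)) as (p & q & Hu & _).
    apply filterdiff_differentiable_pt_lim in Hu.
    apply (filterdiff_continuous (fun z : R * R => u (fst z) (snd z)) (x, y)).
    eexists; exact Hu. }
set (rho := r / 2).
assert (Hu : exists d, 0 < d /\ forall t, 0 < t < d -> u px py - eps * rho ^ 2 / 8 < u (px + t) py).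
{ destruct (Hcr px py ltac:(lra) ltac:(lra)) as (p & q & Hu & _).
  assert (HC : continuity_2d_pt u px py)
    by (apply differentiable_continuity_pt; exists p, (- q); auto).
  assert (Hp : 0 < eps * rho ^ 2 / 8).
  { assert (0 < rho ^ 2) by (apply pow_lt; unfold rho; lra).
    assert (0 < eps * rho ^ 2) by (apply Rmult_lt_0_compat; lra). lra. }
  destruct (HC (mkposreal _ Hp)) as [d Hd]. exists d; split; [apply cond_pos|].
  intros t Ht. specialize (Hd (px + t) py).
  assert (Hd' : Rabs (u (px + t) py - u px py) < eps * rho ^ 2 / 8).
  { apply Hd.
    - replace (px + t - px) with t by ring. apply Rabs_def1; lra.
    - rewrite Rminus_diag_eq, Rabs_R0; auto. apply cond_pos. }
  apply Rabs_def2 in Hd'. lra. }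
destruct Hu as (d & Hd & Hu).
set (h := Rmin (d / 2) (rho / 2)).
assert (Hh : 0 < h < d /\ h <= rho / 2).
{ assert (M1 := Rmin_l (d / 2) (rho / 2)). assert (M2 := Rmin_r (d / 2) (rho / 2)).
  assert (0 < h) by (apply Rmin_pos; unfold rho; lra). unfold h in *; lra. }
assert (Hrho : 0 < rho /\ r = 2 * rho) by (unfold rho; lra).
clearbody h rho. destruct Hrho as [Hrho ->].
(* A difference quotient of [U], hence close to [u], plus a term of positive Laplacian. The factor
   1/16 is small enough against the decay of [u] to keep the maximum of [Psi] off the boundary. *)
pose (Psi := fun x y => (U (x + h) y - U x y) * / h + eps / 16 * ((x - px) ^ 2 + (y - py) ^ 2)).
assert (HPsi : forall x y, px - rho <= x <= px + rho -> py - rho <= y <= py + rho ->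
  exists t, 0 < t < h /\
    Psi x y = u (x + t) y + eps / 16 * ((x - px) ^ 2 + (y - py) ^ 2)).
{ intros x y Hx Hy.
  destruct (MVT_cor2 (fun z => U z y) (fun z => u z y) x (x + h)) as (z & Hz & Hzi); try lra.
  { intros z Hz. apply is_derive_Reals. apply HU; lra. }
  exists (z - x). split; [lra|]. unfold Psi. rewrite Hz.
  replace (x + (z - x)) with z by ring. field; lra. }
destruct (box_max Psi (px - rho) (px + rho) (py - rho) (py + rho)) as (X & Y & HX & HY & HM);
  try lra.
{ intros x y Hx Hy e Hee.
  assert (HC : continuity_2d_pt Psi x y).
  { unfold Psi. apply continuity_2d_pt_plus.
    - apply continuity_2d_pt_mult; [|apply continuity_2d_pt_const].
      apply continuity_2d_pt_minus; [|apply HUc; lra].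
      intros e'. destruct (HUc (x + h) y ltac:(lra) ltac:(lra) e') as [d' Hd'].
      exists d'. intros x' y' Hx' Hy'. apply Hd'; auto.
      replace (x' + h - (x + h)) with (x' - x) by ring. auto.
    - simpl. repeat (apply continuity_2d_pt_plus || apply continuity_2d_pt_minus ||
        apply continuity_2d_pt_mult || apply continuity_2d_pt_const ||
        apply continuity_2d_pt_id1 || apply continuity_2d_pt_id2). }
  destruct (continuity_2d_pt_usc Psi x y HC e Hee) as (d' & Hd' & H).
  exists d'; auto. }
assert (Hctr : u px py - eps * rho ^ 2 / 8 < Psi X Y).
{ apply Rlt_le_trans with (Psi px py); [|apply HM; lra].
  destruct (HPsi px py ltac:(lra) ltac:(lra)) as (t & Ht & ->).
  specialize (Hu t ltac:(lra)).
  replace ((px - px) ^ 2 + (py - py) ^ 2) with 0 by ring. lra. }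
(* At distance rho in one coordinate, t < h <= rho / 2 makes the decay of [u] cost at least eps
   rho^2 / 4, while the slack at the centre and the quadratic term gain less than eps rho^2 (1/8 +
   1/8). *)
assert (Hedge : (X - px) ^ 2 < rho ^ 2 /\ (Y - py) ^ 2 < rho ^ 2).
{ destruct (HPsi X Y HX HY) as (t & Ht & E). rewrite E in Hctr.
  specialize (Hmax (X + t) Y ltac:(lra) ltac:(lra)).
  assert (B : eps * ((X + t - px) ^ 2 + (Y - py) ^ 2) <
    eps * (rho ^ 2 / 8 + ((X - px) ^ 2 + (Y - py) ^ 2) / 16)) by lra.
  apply Rmult_lt_reg_l in B; auto.
  assert (BX : (X - px) ^ 2 <= rho ^ 2) by nra.
  assert (BY : (Y - py) ^ 2 <= rho ^ 2) by nra.
  split.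
  - apply Rnot_le_lt. intros K.
    assert ((X + t - px) ^ 2 >= rho ^ 2 / 4).
    { destruct (Rle_dec (X - px) 0).
      - assert (X - px <= - rho) by nra. nra.
      - assert (rho <= X - px) by nra. nra. }
    assert (0 <= (Y - py) ^ 2) by apply pow2_ge_0. lra.
  - apply Rnot_le_lt. intros K. assert (0 <= (X + t - px) ^ 2) by apply pow2_ge_0.
    assert (0 < rho ^ 2) by (apply pow_lt; lra). lra. }
assert (HX' : px - rho < X < px + rho) by nra.
assert (HY' : py - rho < Y < py + rho) by nra.
destruct (Hcr X Y ltac:(lra) ltac:(lra)) as (p1 & q1 & Hu1 & Hv1).
destruct (Hcr (X + h) Y ltac:(lra) ltac:(lra)) as (p2 & q2 & Hu2 & Hv2).
assert (Hshift : forall (g : R -> R) z l, is_derive g (z + h) l -> is_derive (fun t => g (t + h)) z l).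
{ intros g z l Hg. replace l with (scal 1 l) by apply @scal_one.
  apply (is_derive_comp g (fun t => t + h)); auto.
  auto_derive; auto. }
assert (T1 : (p2 - p1) * / h + eps / 8 <= 0).
{ set (r1 := Rmin (X - (px - rho)) (px + rho - X)).
  assert (Hr1 : 0 < r1) by (apply Rmin_pos; lra).
  assert (Hin : forall t, Rabs (t - X) < r1 -> px - rho < t < px + rho).
  { intros t Ht. apply Rabs_def2 in Ht.
    assert (M1 := Rmin_l (X - (px - rho)) (px + rho - X)).
    assert (M2 := Rmin_r (X - (px - rho)) (px + rho - X)). unfold r1 in Ht. lra. }
  apply (second_derivative_nonpos_at_max (fun x => Psi x Y)
    (fun x => (u (x + h) Y - u x Y) * / h + eps / 8 * (x - px)) X _ r1 Hr1).
  - intros t Ht. specialize (Hin t Ht). unfold Psi.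
    apply @is_derive_plus; [|auto_derive; auto; field].
    replace ((u (t + h) Y - u t Y) * / h) with (/ h * (u (t + h) Y - u t Y)) by ring.
    apply is_derive_ext with (fun x => / h * (U (x + h) Y - U x Y)); [intros; simpl; ring|].
    apply is_derive_scal. apply @is_derive_minus.
    + apply Hshift with (g := fun x => U x Y). apply HU; lra.
    + apply HU; lra.
  - apply @is_derive_plus; [|auto_derive; auto; field].
    replace ((p2 - p1) * / h) with (/ h * (p2 - p1)) by ring.
    apply is_derive_ext with (fun x => / h * (u (x + h) Y - u x Y)); [intros; simpl; ring|].
    apply is_derive_scal. apply @is_derive_minus.
    + apply Hshift with (g := fun x => u x Y). apply differentiable_derive_l with (1 := Hu2).
    + apply differentiable_derive_l with (1 := Hu1).
  - intros t Ht. specialize (Hin t Ht). apply HM; lra. }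
(* As [U] has y-derivative -v, Cauchy-Riemann makes this quotient the opposite of the one in [T1];
   adding the two leaves eps / 4 <= 0. *)
assert (T2 : (p1 - p2) * / h + eps / 8 <= 0).
{ set (r1 := Rmin (Y - (py - rho)) (py + rho - Y)).
  assert (Hr1 : 0 < r1) by (apply Rmin_pos; lra).
  assert (Hin : forall t, Rabs (t - Y) < r1 -> py - rho < t < py + rho).
  { intros t Ht. apply Rabs_def2 in Ht.
    assert (M1 := Rmin_l (Y - (py - rho)) (py + rho - Y)).
    assert (M2 := Rmin_r (Y - (py - rho)) (py + rho - Y)). unfold r1 in Ht. lra. }
  apply (second_derivative_nonpos_at_max (fun y => Psi X y)
    (fun y => (v X y - v (X + h) y) * / h + eps / 8 * (y - py)) Y _ r1 Hr1).
  - intros t Ht. specialize (Hin t Ht). unfold Psi.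
    apply @is_derive_plus; [|auto_derive; auto; field].
    replace ((v X t - v (X + h) t) * / h) with (/ h * (- v (X + h) t - - v X t)) by ring.
    apply is_derive_ext with (fun y => / h * (U (X + h) y - U X y)); [intros; simpl; ring|].
    apply is_derive_scal. apply @is_derive_minus; apply HU; lra.
  - apply @is_derive_plus; [|auto_derive; auto; field].
    replace ((p1 - p2) * / h) with (/ h * (p1 - p2)) by ring.
    apply is_derive_ext with (fun y => / h * (v X y - v (X + h) y)); [intros; simpl; ring|].
    apply is_derive_scal. apply @is_derive_minus.
    + apply differentiable_derive_r with (1 := Hv1).
    + apply differentiable_derive_r with (1 := Hv2).
  - intros t Ht. specialize (Hin t Ht). apply HM; lra. }
lra.
Qed.

Lemma differentiable_pt_lim_add_affine (f : R -> R -> R) x y p q A B a b :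
  differentiable_pt_lim f x y p q ->
  differentiable_pt_lim (fun u v => f u v + (A * (u - a) + B * (v - b))) x y (p + A) (q + B).
Proof.
intros H eps. destruct (H eps) as [d Hd]. exists d. intros u v Hu Hv.
replace (f u v + (A * (u - a) + B * (v - b)) - (f x y + (A * (x - a) + B * (y - b)))
    - ((p + A) * (u - x) + (q + B) * (v - y)))
  with (f u v - f x y - (p * (u - x) + q * (v - y))) by ring.
auto.
Qed.

(** A value above [M] survives the addition of a small multiple of the squared distance to the
    corner (a, c), so the sum has an interior maximum. Expanding the square there gives quadratic
    decay for [u] plus an affine function. *)
Lemma max_principle (u v : R -> R -> R) (a b c d M : R) :
  a <= b -> c <= d ->
  (forall x y, a <= x <= b -> c <= y <= d -> forall eps, 0 < eps ->
     exists delta, 0 < delta /\ forall x' y', a <= x' <= b -> c <= y' <= d ->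
       Rabs (x' - x) < delta -> Rabs (y' - y) < delta -> u x' y' < u x y + eps) ->
  (forall x y, a < x < b -> c < y < d -> cauchy_riemann_at u v x y) ->
  (forall x y, a <= x <= b -> c <= y <= d -> (x = a \/ x = b) \/ (y = c \/ y = d) ->
     u x y <= M) ->
  forall x y, a <= x <= b -> c <= y <= d -> u x y <= M.
Proof.
intros Hab Hcd Hcont Hcr Hbd x0 y0 Hx0 Hy0. apply Rnot_lt_le. intros Hlt.
set (D := (b - a) ^ 2 + (d - c) ^ 2).
assert (HD : 0 <= D).
{ unfold D. assert (H1 := pow2_ge_0 (b - a)). assert (H2 := pow2_ge_0 (d - c)). lra. }
set (eps := (u x0 y0 - M) / (D + 1)).
assert (He : 0 < eps) by (apply Rdiv_lt_0_compat; lra).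
assert (HeD : eps * D < u x0 y0 - M).
{ replace (u x0 y0 - M) with (eps * (D + 1)) by (unfold eps; field; lra).
  apply Rmult_lt_compat_l; lra. }
pose (N := fun x y => (x - a) ^ 2 + (y - c) ^ 2).
assert (HN : forall x y, a <= x <= b -> c <= y <= d -> 0 <= N x y <= D).
{ intros x y Hx Hy. unfold N, D. split.
  - assert (H1 := pow2_ge_0 (x - a)). assert (H2 := pow2_ge_0 (y - c)). lra.
  - apply Rplus_le_compat; apply pow_incr; lra. }
destruct (box_max (fun x y => u x y + eps * N x y) a b c d) as (px & py & Hpx & Hpy & Hm); auto.
{ intros x y Hx Hy e Hepos.
  destruct (Hcont x y Hx Hy (e / 2) ltac:(lra)) as (d1 & Hd1 & H1).
  assert (HC : continuity_2d_pt (fun x y => eps * N x y) x y).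
  { unfold N. simpl. repeat (apply continuity_2d_pt_plus || apply continuity_2d_pt_minus ||
        apply continuity_2d_pt_mult || apply continuity_2d_pt_const ||
        apply continuity_2d_pt_id1 || apply continuity_2d_pt_id2). }
  destruct (continuity_2d_pt_usc _ x y HC (e / 2) ltac:(lra)) as (d2 & Hd2 & H2).
  exists (Rmin d1 d2). assert (M1 := Rmin_l d1 d2). assert (M2 := Rmin_r d1 d2).
  split; [apply Rmin_pos; auto|]. intros x' y' Hx' Hy' Hxx Hyy.
  specialize (H1 x' y' Hx' Hy' ltac:(lra) ltac:(lra)).
  specialize (H2 x' y' ltac:(lra) ltac:(lra)). simpl in H2. lra. }
assert (Hbig : M < u px py).
{ assert (K1 := Hm x0 y0 Hx0 Hy0). simpl in K1.
  assert (K2 := HN x0 y0 Hx0 Hy0). assert (K3 := HN px py Hpx Hpy).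
  assert (eps * N px py <= eps * D) by (apply Rmult_le_compat_l; lra).
  assert (0 <= eps * N x0 y0) by (apply Rmult_le_pos; lra). lra. }
assert (Hin : a < px < b /\ c < py < d).
{ assert (K := Hbd px py Hpx Hpy).
  destruct (Req_dec px a); [specialize (K ltac:(auto)); lra|].
  destruct (Req_dec px b); [specialize (K ltac:(auto)); lra|].
  destruct (Req_dec py c); [specialize (K ltac:(auto)); lra|].
  destruct (Req_dec py d); [specialize (K ltac:(auto)); lra|]. lra. }
set (r := Rmin (Rmin (px - a) (b - px)) (Rmin (py - c) (d - py)) / 2).
assert (Hr : 0 < r /\ r < px - a /\ r < b - px /\ r < py - c /\ r < d - py).
{ assert (M1 := Rmin_l (px - a) (b - px)). assert (M2 := Rmin_r (px - a) (b - px)).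
  assert (M3 := Rmin_l (py - c) (d - py)). assert (M4 := Rmin_r (py - c) (d - py)).
  assert (M5 := Rmin_l (Rmin (px - a) (b - px)) (Rmin (py - c) (d - py))).
  assert (M6 := Rmin_r (Rmin (px - a) (b - px)) (Rmin (py - c) (d - py))).
  assert (0 < Rmin (Rmin (px - a) (b - px)) (Rmin (py - c) (d - py)))
    by (repeat apply Rmin_pos; lra).
  unfold r; lra. }
clearbody r.
(* [A] and [B] form the gradient of the quadratic term at the maximum z0. The affine correction is
   the real part of (A - iB)(z - z0), so Cauchy-Riemann persists once its imaginary part is added to
   [v]. *)
set (A := 2 * eps * (px - a)). set (B := 2 * eps * (py - c)).
apply (real_part_no_strict_max (fun x y => u x y + (A * (x - px) + B * (y - py)))
  (fun x y => v x y + (- B * (x - px) + A * (y - py))) px py r eps); try tauto.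
- intros x y Hx Hy. destruct (Hcr x y ltac:(lra) ltac:(lra)) as (p & q & Hu & Hv).
  exists (p + A), (q + - B). split.
  + replace (- (q + - B)) with (- q + B) by ring.
    apply differentiable_pt_lim_add_affine; auto.
  + apply differentiable_pt_lim_add_affine; auto.
- intros x y Hx Hy. specialize (Hm x y ltac:(lra) ltac:(lra)). unfold N in Hm.
  unfold A, B.
  replace (u px py + (2 * eps * (px - a) * (px - px) + 2 * eps * (py - c) * (py - py)))
    with (u px py) by ring.
  nra.
Qed.

(** * Complex differentiability and the Cauchy-Riemann equations *)

Notation Cderivable := (@ex_derive C_AbsRing C_NormedModule).

(** Strips the filters from the derivative, so that Cauchy-Riemann and the algebraic rules become
    explicit [Cmod] estimates. *)
Lemma is_derive_C_iff (f : C -> C) (s l : C) :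
  @is_derive C_AbsRing C_NormedModule f s l <->
  forall eps, 0 < eps -> exists delta, 0 < delta /\ forall t,
    Cmod (t - s) < delta -> Cmod (f t - f s - (t - s) * l) <= eps * Cmod (t - s).
Proof.
split.
- intros [_ H] eps He.
  destruct (H s (fun P HP => HP) (mkposreal _ He)) as [d Hd].
  exists d; split; [apply cond_pos|]. intros t Ht. apply (Hd t Ht).
- intros H. split; [apply is_linear_scal_l|]. intros x Hx.
  apply (is_filter_lim_locally_unique (V := AbsRing_NormedModule C_AbsRing)) in Hx. subst x. intros eps.
  destruct (H eps (cond_pos eps)) as (d & Hd & Ht).
  exists (mkposreal d Hd). intros t Htd. apply (Ht t Htd).
Qed.

Lemma im_le_Cmod (z : C) : Rabs (Im z) <= Cmod z.
Proof. apply Rle_trans with (2 := Rmax_Cmod z), Rmax_r. Qed.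

Lemma derivable_C_pair (f : C -> C) (x y : R) : Cderivable f (x, y) ->
  cauchy_riemann_at (fun x y => Re (f (x, y))) (fun x y => Im (f (x, y))) x y.
Proof.
intros [l Hl]. assert (Hl' := proj1 (is_derive_C_iff f (x, y) l) Hl). clear Hl.
assert (K : forall eps : posreal, exists d : posreal, forall x' y',
  Rabs (x' - x) < d -> Rabs (y' - y) < d ->
  Cmod (f (x', y') - f (x, y) - ((x', y') - (x, y)) * l)
    <= eps * Rmax (Rabs (x' - x)) (Rabs (y' - y))).
{ intros eps.
  assert (H2 : 0 < sqrt 2) by (apply sqrt_lt_R0; lra).
  (* [Cmod] is at most sqrt 2 times the maximum norm; the factor is paid once in the error and once
     in the radius. *)
  destruct (Hl' (eps / sqrt 2)) as (d & Hd & H).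
  { apply Rdiv_lt_0_compat; [apply cond_pos|auto]. }
  assert (Hd2 : 0 < d / sqrt 2) by (apply Rdiv_lt_0_compat; auto).
  exists (mkposreal _ Hd2). simpl. intros x' y' Hx Hy.
  assert (HC := Cmod_2Rmax ((x', y') - (x, y))). simpl in HC.
  fold (Rminus x' x) in HC. fold (Rminus y' y) in HC.
  eapply Rle_trans; [apply H|].
  - eapply Rle_lt_trans; [apply HC|].
    replace d with (sqrt 2 * (d / sqrt 2)) by (field; lra).
    apply Rmult_lt_compat_l; auto. apply Rmax_lub_lt; auto.
  - apply Rle_trans with (eps / sqrt 2 * (sqrt 2 * Rmax (Rabs (x' - x)) (Rabs (y' - y)))).
    + apply Rmult_le_compat_l; auto. apply Rlt_le, Rdiv_lt_0_compat; [apply cond_pos|auto].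
    + right. field. lra. }
exists (Re l), (Im l). split; intros eps; destruct (K eps) as [d Hd]; exists d;
  intros x' y' Hx Hy; (eapply Rle_trans; [|apply (Hd x' y' Hx Hy)]).
- eapply Rle_trans; [|apply re_le_Cmod]. right. f_equal. unfold Re, Im. simpl. ring.
- eapply Rle_trans; [|apply im_le_Cmod]. right. f_equal. unfold Re, Im. simpl. ring.
Qed.

(** * Complex derivatives on the half-plane *)

Lemma derivable_C_plus (f g : C -> C) s : Cderivable f s -> Cderivable g s ->
  Cderivable (fun t => f t + g t)%C s.
Proof. intros; apply @ex_derive_plus; auto. Qed.

Lemma derivable_C_minus (f g : C -> C) s : Cderivable f s -> Cderivable g s ->
  Cderivable (fun t => f t - g t)%C s.
Proof. intros; apply @ex_derive_minus; auto. Qed.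

Lemma derivable_C_const (c : C) s : Cderivable (fun _ => c) s.
Proof. apply @ex_derive_const. Qed.

Lemma derivable_C_id s : Cderivable (fun t => t) s.
Proof.
exists (RtoC 1). apply is_derive_C_iff. intros eps He. exists 1; split; [lra|]. intros t _.
replace (t - s - (t - s) * 1)%C with (RtoC 0) by ring. rewrite Cmod_0.
apply Rmult_le_pos; [lra|apply Cmod_ge_0].
Qed.

Lemma derivable_C_square s : Cderivable (fun t => t * t)%C s.
Proof.
exists (RtoC 2 * s)%C. apply is_derive_C_iff. intros eps He. exists eps; split; auto. intros t Ht.
replace (t * t - s * s - (t - s) * (2 * s))%C with ((t - s) * (t - s))%C by ring.
rewrite Cmod_mult. apply Rmult_le_compat_r; [apply Cmod_ge_0|lra].
Qed.

Lemma derivable_C_scal (c : C) (f : C -> C) s : Cderivable f s ->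
  Cderivable (fun t => c * f t)%C s.
Proof.
intros [l Hl]. exists (c * l)%C. apply is_derive_C_iff. intros eps He.
assert (Hc := Cmod_ge_0 c).
destruct (proj1 (is_derive_C_iff f s l) Hl (eps / (Cmod c + 1))) as (d & Hd & H).
{ apply Rdiv_lt_0_compat; lra. }
exists d; split; auto. intros t Ht. specialize (H t Ht).
replace (c * f t - c * f s - (t - s) * (c * l))%C with (c * (f t - f s - (t - s) * l))%C by ring.
rewrite Cmod_mult. apply (Rmult_le_compat_l _ _ _ Hc) in H.
eapply Rle_trans; [exact H|].
replace (Cmod c * (eps / (Cmod c + 1) * Cmod (t - s)))
  with (eps * Cmod (t - s) * (Cmod c / (Cmod c + 1))) by (field; lra).
rewrite <- (Rmult_1_r (eps * Cmod (t - s))) at 2. apply Rmult_le_compat_l.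
- apply Rmult_le_pos; [lra|apply Cmod_ge_0].
- apply Rle_div_l; lra.
Qed.

Lemma derivable_C_continuous (f : C -> C) s : Cderivable f s ->
  forall eps, 0 < eps -> exists delta, 0 < delta /\ forall t,
    Cmod (t - s) < delta -> Cmod (f t - f s) < eps.
Proof.
intros [l Hl] eps He.
destruct (proj1 (is_derive_C_iff f s l) Hl 1 Rlt_0_1) as (d & Hd & H).
assert (HL := Cmod_ge_0 l).
exists (Rmin d (eps / (Cmod l + 2))). split.
{ apply Rmin_pos; auto. apply Rdiv_lt_0_compat; lra. }
intros t Ht. assert (M1 := Rmin_l d (eps / (Cmod l + 2))).
assert (M2 := Rmin_r d (eps / (Cmod l + 2))).
specialize (H t ltac:(lra)).
replace (f t - f s)%C with ((f t - f s - (t - s) * l) + (t - s) * l)%C by ring.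
eapply Rle_lt_trans; [apply Cmod_triangle|]. rewrite Cmod_mult.
assert (Hlt : Cmod (t - s) < eps / (Cmod l + 2)) by lra.
apply Rlt_div_r in Hlt; [|lra]. assert (H0 := Cmod_ge_0 (t - s)). nra.
Qed.

Lemma derivable_C_inv (f : C -> C) s : Cderivable f s -> f s <> 0%C ->
  Cderivable (fun t => / f t)%C s.
Proof.
intros Hf Hs. assert (Hcont := derivable_C_continuous f s Hf). destruct Hf as [l Hl].
exists (- l / (f s * f s))%C. apply is_derive_C_iff. intros eps He.
set (m := Cmod (f s)). assert (Hm : 0 < m) by (apply Cmod_gt_0; auto).
set (L := Cmod l). assert (HL : 0 <= L) by apply Cmod_ge_0.
assert (Hm2 : 0 < m ^ 2) by (apply pow_lt; auto).
assert (Hm3 : 0 < m ^ 3) by (apply pow_lt; auto).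
(* The two terms of the numerator below each get eps m^3 h / 4, and |f t| > m / 2 in the denominator
   absorbs their sum. The 1 in L + 1 covers l = 0. *)
destruct (proj1 (is_derive_C_iff f s l) Hl (eps * m ^ 2 / 4)) as (d1 & Hd1 & H1).
{ assert (0 < eps * m ^ 2) by (apply Rmult_lt_0_compat; auto). lra. }
destruct (Hcont (m / 2) ltac:(lra)) as (d2 & Hd2 & H2).
destruct (Hcont (eps * m ^ 3 / (4 * (L + 1)))) as (d3 & Hd3 & H3).
{ apply Rdiv_lt_0_compat; [apply Rmult_lt_0_compat|]; lra. }
exists (Rmin d1 (Rmin d2 d3)). split; [repeat apply Rmin_pos; auto|]. intros t Ht.
assert (M1 := Rmin_l d1 (Rmin d2 d3)). assert (M2 := Rmin_r d1 (Rmin d2 d3)).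
assert (M3 := Rmin_l d2 d3). assert (M4 := Rmin_r d2 d3).
specialize (H1 t ltac:(lra)). specialize (H2 t ltac:(lra)). specialize (H3 t ltac:(lra)).
set (h := Cmod (t - s)) in *. assert (Hh : 0 <= h) by apply Cmod_ge_0.
assert (Hft : m / 2 < Cmod (f t)).
{ assert (T := Cmod_triangle (f t) (- (f t - f s))).
  replace (f t + - (f t - f s))%C with (f s) in T by ring. rewrite Cmod_opp in T.
  fold m in T. lra. }
assert (Hft0 : f t <> 0%C) by (intros E; rewrite E, Cmod_0 in Hft; lra).
replace (/ f t - / f s - (t - s) * (- l / (f s * f s)))%C
  with ((- ((f t - f s - (t - s) * l) * f s) + (t - s) * (l * (f t - f s)))
        / (f t * (f s * f s)))%C by (field; auto).
assert (Hden : (f t * (f s * f s))%C <> 0%C) by (repeat apply Cmult_neq_0; auto).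
rewrite Cmod_div; auto. rewrite !(Cmod_mult (f t)), (Cmod_mult (f s)). fold m.
assert (Hfp : 0 < Cmod (f t)) by lra.
apply Rle_div_l; [repeat apply Rmult_lt_0_compat; auto|].
eapply Rle_trans; [apply Cmod_triangle|]. rewrite Cmod_opp, !Cmod_mult.
fold m h L.
assert (A1 : Cmod (f t - f s - (t - s) * l) * m <= eps * m ^ 2 / 4 * h * m)
  by (apply Rmult_le_compat_r; lra).
assert (A2 : L * Cmod (f t - f s) <= eps * m ^ 3 / 4).
{ apply Rle_trans with (L * (eps * m ^ 3 / (4 * (L + 1)))).
  - apply Rmult_le_compat_l; lra.
  - replace (L * (eps * m ^ 3 / (4 * (L + 1)))) with (eps * m ^ 3 / 4 * (L / (L + 1))) by (field; lra).
    rewrite <- (Rmult_1_r (eps * m ^ 3 / 4)) at 2. apply Rmult_le_compat_l.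
    + assert (0 < eps * m ^ 3) by (apply Rmult_lt_0_compat; lra). lra.
    + apply Rle_div_l; lra. }
apply (Rmult_le_compat_l h _ _ Hh) in A2.
assert (A3 : eps * h * (m * m) * (m / 2) <= eps * h * (m * m) * Cmod (f t)).
{ apply Rmult_le_compat_l; [|lra]. repeat apply Rmult_le_pos; lra. }
nra.
Qed.

Definition continuous_on_C0bar_at (f : C -> C) (s : C) : Prop :=
  forall eps, 0 < eps -> exists delta, 0 < delta /\ forall t,
    C0bar t -> Cmod (t - s) < delta -> Cmod (f t - f s) < eps.

Lemma derivable_continuous_on_C0bar (f : C -> C) s :
  Cderivable f s -> continuous_on_C0bar_at f s.
Proof.
intros Hf eps He. destruct (derivable_C_continuous f s Hf eps He) as (d & Hd & H).
exists d; auto.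
Qed.

Lemma continuous_on_C0bar_minus (f g : C -> C) s :
  continuous_on_C0bar_at f s -> continuous_on_C0bar_at g s ->
  continuous_on_C0bar_at (fun t => f t - g t)%C s.
Proof.
intros Hf Hg eps He.
destruct (Hf (eps / 2) ltac:(lra)) as (d1 & Hd1 & H1).
destruct (Hg (eps / 2) ltac:(lra)) as (d2 & Hd2 & H2).
exists (Rmin d1 d2); split; [apply Rmin_pos; auto|]. intros t Ht Hts.
assert (M1 := Rmin_l d1 d2). assert (M2 := Rmin_r d1 d2).
specialize (H1 t Ht ltac:(lra)). specialize (H2 t Ht ltac:(lra)).
replace (f t - g t - (f s - g s))%C with ((f t - f s) + - (g t - g s))%C by ring.
eapply Rle_lt_trans; [apply Cmod_triangle|]. rewrite Cmod_opp. lra.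
Qed.

Lemma Cmod_lt_of_coord (x y x' y' d : R) :
  Rabs (x' - x) < d / 2 -> Rabs (y' - y) < d / 2 -> Cmod ((x', y') - (x, y)) < d.
Proof.
intros Hx Hy. eapply Rle_lt_trans; [apply Cmod_2Rmax|]. simpl.
fold (Rminus x' x). fold (Rminus y' y).
assert (H2 : sqrt 2 < 2).
{ rewrite <- (sqrt_square 2) at 2 by lra. apply sqrt_lt_1; lra. }
assert (H0 : 0 <= sqrt 2) by apply sqrt_pos.
assert (Hm : Rmax (Rabs (x' - x)) (Rabs (y' - y)) < d / 2) by (apply Rmax_lub_lt; auto).
assert (Hm0 : 0 <= Rmax (Rabs (x' - x)) (Rabs (y' - y)))
  by (apply Rle_trans with (2 := Rmax_l _ _), Rabs_pos).
nra.
Qed.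

Lemma filterlim_continuous_on_C0bar (f : C -> C) s :
  filterlim f (within C0bar (locally s)) (locally (f s)) -> continuous_on_C0bar_at f s.
Proof.
intros H eps He.
destruct (H (fun z => Cmod (z - f s) < eps)) as [d Hd].
{ assert (He2 : 0 < eps / 2) by lra. exists (mkposreal _ He2).
  intros [x y] [Hx Hy]. destruct (f s) as [x0 y0]. apply Cmod_lt_of_coord; auto. }
exists d; split; [apply cond_pos|]. intros t Ht Hts. apply Hd; auto.
apply C_NormedModule_mixin_compat1, Hts.
Qed.

Lemma max_principle_C0 (f : C -> C) (a b c d M : R) :
  0 <= a <= b -> c <= d -> (forall s, C0 s -> Cderivable f s) ->
  (forall s, a <= Re s <= b -> c <= Im s <= d -> continuous_on_C0bar_at f s) ->
  (forall x y, a <= x <= b -> c <= y <= d -> (x = a \/ x = b) \/ (y = c \/ y = d) ->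
     Re (f (x, y)) <= M) ->
  forall x y, a <= x <= b -> c <= y <= d -> Re (f (x, y)) <= M.
Proof.
intros Hab Hcd Hf Hcont Hbd.
apply (max_principle (fun x y => Re (f (x, y))) (fun x y => Im (f (x, y))) a b c d M); auto.
- lra.
- intros x y Hx Hy eps He. destruct (Hcont (x, y) Hx Hy eps He) as (d' & Hd & H).
  exists (d' / 2); split; [lra|]. intros x' y' Hx' Hy' Hxx Hyy.
  assert (K := Cmod_lt_of_coord x y x' y' d' Hxx Hyy).
  apply H in K; [|unfold C0bar; simpl; lra].
  assert (K' := Rle_lt_trans _ _ _ (re_le_Cmod _) K). apply Rabs_def2 in K'.
  destruct (f (x', y')), (f (x, y)). unfold Re in *. simpl in *. lra.
- intros x y Hx Hy. apply derivable_C_pair, Hf. unfold C0; simpl; lra.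
Qed.

(** * Estimates for functions with positive real part *)

(** All bounds come from Re (1 / z) = Re z / |z|^2. *)
Lemma Re_Cinv_bounds (z : C) : 0 < Re z ->
  0 < Re (/ z) <= / Re z /\ forall N, Cmod z <= N -> Re z / N ^ 2 <= Re (/ z).
Proof.
intros Hz. assert (Hn := Cmod2_alt z).
assert (E : Re (/ z) = Re z / (Cmod z ^ 2)) by (rewrite Hn; destruct z; reflexivity).
assert (Him := pow2_ge_0 (Im z)).
assert (Hpos : 0 < Cmod z ^ 2) by nra.
rewrite E. repeat split.
- apply Rdiv_lt_0_compat; auto.
- apply Rle_div_l; auto. apply Rmult_le_reg_l with (Re z); auto.
  rewrite <- Rmult_assoc, Rinv_r, Rmult_1_l by lra. nra.
- intros N HN. apply Rmult_le_compat_l; [lra|]. apply Rinv_le_contravar; auto.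
  apply pow_incr. split; [apply Cmod_ge_0|auto].
Qed.

Lemma Cmod_le_abs_coord (x y : R) : Cmod (x, y) <= Rabs x + Rabs y.
Proof.
replace (x, y) with (RtoC x + Ci * RtoC y)%C
  by (apply injective_projections; simpl; ring).
eapply Rle_trans; [apply Cmod_triangle|].
rewrite Cmod_mult, Cmod_Ci, !Cmod_R. lra.
Qed.

(* The minimum principle is applied to the real part of 1 / (f - i c y0), compared on a
   box around height y0 with the harmonic function kappa * (X + X^2 - Y^2). *)
Lemma harnack_near_boundary (f : C -> C) (c sigma N0 : R) :
  0 < sigma -> 0 <= c -> (forall s, C0 s -> Cderivable f s) ->
  (forall s, C0 s -> 1 <= Re (f s)) ->
  (forall s, Re s = sigma -> Cmod (f s - RtoC c * s) <= N0) ->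
  exists K, 0 <= K /\ forall s, 0 < Re s <= sigma -> Re (f s) <= K / Re s.
Proof.
intros Hsig Hc Hf H1 HN0.
(* [L] is the half-height of the box. Subtracting i c y0 removes the growth of c s with the height,
   so [N] bounds the right edge uniformly in y0. *)
set (L := sigma + 1). set (N := N0 + c * (sigma + L)).
assert (HN1 : forall y0 y, Rabs (y - y0) <= L -> Cmod (f (sigma, y) - (0, (c * y0)%R)) <= N).
{ intros y0 y Hy.
  replace (f (sigma, y) - (0, (c * y0)%R))%C
    with ((f (sigma, y) - RtoC c * (sigma, y)) + RtoC c * (sigma, (y - y0)%R))%C.
  2: { destruct (f (sigma, y)); apply injective_projections; simpl; ring. }
  eapply Rle_trans; [apply Cmod_triangle|]. rewrite Cmod_mult, Cmod_R, (Rabs_pos_eq c Hc).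
  apply Rplus_le_compat; [apply HN0; reflexivity|]. apply Rmult_le_compat_l; auto.
  eapply Rle_trans; [apply Cmod_le_abs_coord|]. rewrite (Rabs_pos_eq sigma); lra. }
assert (HNpos : 1 <= N).
{ assert (K := HN1 0 0 ltac:(rewrite Rminus_0_r, Rabs_R0; unfold L; lra)).
  assert (K1 := H1 (sigma, 0) Hsig).
  eapply Rle_trans; [|exact K]. eapply Rle_trans; [|apply re_le_Cmod].
  eapply Rle_trans; [|apply Rle_abs]. destruct (f (sigma, 0)); unfold Re in *; simpl in *; lra. }
clearbody N.
assert (HNL : 0 < N ^ 2 * L ^ 2).
{ apply Rmult_lt_0_compat; apply pow_lt; unfold L; lra. }
(* On the right edge X + X^2 <= L^2, so the barrier is at most kappa L^2 = 1 / N^2, a lower bound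
   there for the real part of the inverse. *)
set (kappa := / (N ^ 2 * L ^ 2)).
assert (Hk : 0 < kappa) by (apply Rinv_0_lt_compat; auto).
exists (2 / kappa). split; [apply Rlt_le, Rdiv_lt_0_compat; lra|].
intros [x0 y0] Hx0. unfold Re in Hx0; simpl in Hx0.
assert (HW1 : forall x y, 0 < x -> 1 <= Re (f (x, y) - (0, (c * y0)%R))).
{ intros x y Hx. specialize (H1 (x, y) Hx). destruct (f (x, y)); unfold Re in *; simpl in *; lra. }
assert (HW : forall s, C0 s -> 1 <= Re (f s - (0, (c * y0)%R))) by (intros [x y] Hx; apply HW1, Hx).
(* The left edge stays inside the half-plane, so no boundary values enter. The barrier is
   nonpositive on it and at least kappa x0 / 2 at the point itself, whence the constant 2 /
   kappa. *)
set (delta := x0 / 2).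
assert (Hbar : forall x y,
  Re (RtoC kappa * (((x, y) - (delta, y0)) + ((x, y) - (delta, y0)) * ((x, y) - (delta, y0))))
  = kappa * ((x - delta) + (x - delta) ^ 2 - (y - y0) ^ 2)).
{ intros x y. unfold Re; simpl. ring. }
assert (HReminus : forall z w : C, Re (z - w) = Re z - Re w) by (intros [] []; reflexivity).
assert (Hder : forall s, C0 s -> Cderivable (fun s =>
  RtoC kappa * ((s - (delta, y0)) + (s - (delta, y0)) * (s - (delta, y0)))
  - / (f s - (0, (c * y0)%R)))%C s).
{ intros s Hs. apply derivable_C_minus.
  - apply derivable_C_scal, derivable_C_plus.
    + apply derivable_C_minus; [apply derivable_C_id|apply derivable_C_const].
    + apply ex_derive_ext with
        (fun t => t * t + RtoC (-2) * ((delta, y0) * t) + (delta, y0) * (delta, y0))%C.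
      { intros t. change (t * t + RtoC (-2) * ((delta, y0) * t) + (delta, y0) * (delta, y0)
          = (t - (delta, y0)) * (t - (delta, y0)))%C.
        destruct t; apply injective_projections; simpl; ring. }
      apply derivable_C_plus; [apply derivable_C_plus|apply derivable_C_const].
      * apply derivable_C_square.
      * apply derivable_C_scal, derivable_C_scal, derivable_C_id.
  - apply derivable_C_inv.
    + apply derivable_C_minus; [auto|apply derivable_C_const].
    + intros E. specialize (HW s Hs). rewrite E in HW. unfold Re in HW; simpl in HW; lra. }
assert (Hmain := max_principle_C0 _ delta sigma (y0 - L) (y0 + L) 0
  ltac:(unfold delta; lra) ltac:(unfold L; lra) Hder).
assert (HL2 : 1 < L) by (unfold L; lra).
assert (Hm : Re (RtoC kappa * (((x0, y0) - (delta, y0)) + ((x0, y0) - (delta, y0)) * ((x0, y0) - (delta, y0)))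
  - / (f (x0, y0) - (0, (c * y0)%R))) <= 0).
{ apply Hmain; try (unfold delta; lra).
  - intros s Hs _. apply derivable_continuous_on_C0bar, Hder. unfold C0, delta in *; lra.
  - intros x y Hx Hy Hb. rewrite HReminus, Hbar.
    assert (Hxp : 0 < x) by (unfold delta in *; lra).
    destruct (Re_Cinv_bounds (f (x, y) - (0, (c * y0)%R))%C) as ((P1 & P2) & P3).
    { specialize (HW1 x y Hxp); lra. }
    assert (HY : (y - y0) ^ 2 <= L ^ 2) by nra.
    assert (HX : (x - delta) + (x - delta) ^ 2 <= L ^ 2) by (unfold L, delta in *; nra).
    assert (HY0 := pow2_ge_0 (y - y0)).
    destruct Hb as [[Hb|Hb]|Hb].
    + subst x. replace (delta - delta) with 0 by ring. nra.
    + subst x. specialize (P3 N). specialize (HW1 sigma y Hxp).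
      assert (P4 : / N ^ 2 <= Re (/ (f (sigma, y) - (0, (c * y0)%R)))).
      { eapply Rle_trans; [|apply P3, HN1; apply Rabs_le_between; lra].
        rewrite <- (Rmult_1_l (/ N ^ 2)). apply Rmult_le_compat_r; auto.
        apply Rlt_le, Rinv_0_lt_compat, pow_lt; lra. }
      assert (P5 : kappa * L ^ 2 = / N ^ 2).
      { unfold kappa. field. split; lra. }
      assert (kappa * ((sigma - delta) + (sigma - delta) ^ 2 - (y - y0) ^ 2) <= kappa * L ^ 2)
        by (apply Rmult_le_compat_l; lra).
      lra.
    + assert (HYL : (y - y0) ^ 2 = L ^ 2) by (destruct Hb; subst y; ring).
      assert (kappa * ((x - delta) + (x - delta) ^ 2 - (y - y0) ^ 2) <= 0) by nra.
      lra. }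
rewrite HReminus, Hbar in Hm.
destruct (Re_Cinv_bounds (f (x0, y0) - (0, (c * y0)%R))%C) as ((P1 & P2) & _).
{ specialize (HW1 x0 y0 ltac:(lra)); lra. }
assert (HE : Re (f (x0, y0) - (0, (c * y0)%R)) = Re (f (x0, y0)))
  by (rewrite HReminus; unfold Re; simpl; ring).
rewrite HE in P2. assert (Hf1 := H1 (x0, y0) (proj1 Hx0)).
assert (B : kappa * (x0 / 2) <= / Re (f (x0, y0))).
{ replace (kappa * (x0 - delta + (x0 - delta) ^ 2 - (y0 - y0) ^ 2))
    with (kappa * (x0 / 2) + kappa * (x0 / 2) ^ 2) in Hm by (unfold delta; field).
  assert (0 <= kappa * (x0 / 2) ^ 2) by (apply Rmult_le_pos; [lra|apply pow2_ge_0]). lra. }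
change (Re (x0, y0)) with x0.
apply -> Rle_div_r; [|lra]. apply -> Rle_div_r; [|lra].
apply (Rmult_le_compat_l (Re (f (x0, y0)))) in B; [|lra]. rewrite Rinv_r in B by lra. lra.
Qed.

(* The barrier is (M + K) Re(2 R s - s^2) / R^2, at least M + K on three sides of the box
   [0, R] x [-R, R], plus two translates of 2 K Re(1 / s), which absorb K / Re s along the
   horizontal sides; it tends to 0 at a fixed point as R grows. *)
Lemma phragmen_lindelof_half_plane (g : C -> C) (M K : R) :
  0 <= M -> 0 <= K -> (forall s, C0 s -> Cderivable g s) ->
  (forall s, C0bar s -> continuous_on_C0bar_at g s) ->
  (forall y, Re (g (0, y)) <= 0) ->
  (forall s, C0 s -> Re (g s) <= M + K / Re s) ->
  forall s, C0 s -> Re (g s) <= 0.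
Proof.
intros HM HK Hg Hcont H0 Hgrow [x0 y0] Hx0. unfold C0, Re in Hx0; simpl in Hx0.
apply Rnot_lt_le. intros Hlt.
set (eps := Re (g (x0, y0)) / 2). assert (He : 0 < eps) by (unfold eps; lra).
(* A / R0 bounds the barrier at the fixed point; [R0] is then taken large enough to make this less
   than eps. *)
set (A := (M + K) * (Rabs y0 + 2 * x0) + 16 * K * (x0 + 1)).
assert (Hay := Rabs_pos y0).
assert (Hyb : - Rabs y0 <= y0 <= Rabs y0).
{ split; [|apply Rle_abs]. assert (Q := Rle_abs (- y0)). rewrite Rabs_Ropp in Q. lra. }
assert (HA : 0 <= A).
{ unfold A. apply Rplus_le_le_0_compat; repeat apply Rmult_le_pos; lra. }
set (R0 := 1 + x0 + 2 * Rabs y0 + A / eps).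
assert (HR : 1 <= R0 /\ x0 <= R0 /\ 2 * Rabs y0 <= R0 /\ A < eps * R0).
{ assert (0 <= A / eps) by (apply Rmult_le_pos; [auto|apply Rlt_le, Rinv_0_lt_compat; auto]).
  assert (E : eps * (A / eps) = A) by (field; lra).
  unfold R0. repeat split; try lra.
  rewrite !Rmult_plus_distr_l, E.
  assert (0 < eps * x0) by (apply Rmult_lt_0_compat; lra).
  assert (0 <= eps * (2 * Rabs y0)) by (apply Rmult_le_pos; lra). lra. }
clearbody R0. destruct HR as (HR1 & HRx & HRy & HRA).
(* K / Re s is useless at the corners on the axis; continuity replaces it on a segment of length
   [eta]. *)
assert (Hcorner : forall y, exists d, 0 < d /\ forall x, 0 <= x <= d -> Re (g (x, y)) <= eps).
{ intros y. assert (HC : C0bar (0, y)) by (unfold C0bar; simpl; lra).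
  destruct (Hcont (0, y) HC eps He) as (d & Hd & H).
  exists (d / 4); split; [lra|]. intros x Hx.
  assert (K1 : Cmod ((x, y) - (0, y)) < d).
  { apply Cmod_lt_of_coord; [rewrite Rminus_0_r, Rabs_pos_eq; lra|].
    rewrite Rminus_diag_eq, Rabs_R0; auto; lra. }
  apply H in K1; [|unfold C0bar; simpl; lra].
  assert (K2 := Rle_lt_trans _ _ _ (re_le_Cmod _) K1). apply Rabs_def2 in K2.
  specialize (H0 y). destruct (g (x, y)), (g (0, y)). unfold Re in *; simpl in *; lra. }
destruct (Hcorner R0) as (d1 & Hd1 & HC1). destruct (Hcorner (- R0)) as (d2 & Hd2 & HC2).
set (eta := Rmin 1 (Rmin d1 d2)).
assert (Heta : 0 < eta /\ eta <= 1 /\ eta <= d1 /\ eta <= d2).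
{ assert (M1 := Rmin_l 1 (Rmin d1 d2)). assert (M2 := Rmin_r 1 (Rmin d1 d2)).
  assert (M3 := Rmin_l d1 d2). assert (M4 := Rmin_r d1 d2).
  assert (0 < eta) by (repeat apply Rmin_pos; lra). unfold eta in *; lra. }
clearbody eta. destruct Heta as (He0 & He1 & Hed1 & Hed2).
assert (HR2 : 0 < R0 ^ 2) by (apply pow_lt; lra).
set (c1 := (M + K) / R0 ^ 2).
assert (Hc1 : 0 <= c1) by (apply Rmult_le_pos; [lra|apply Rlt_le, Rinv_0_lt_compat; auto]).
assert (Ec1 : c1 * R0 ^ 2 = M + K) by (unfold c1; field; lra).
(* The poles - eta + i R0 and - eta - i R0 lie outside the closed half-plane. On the horizontal side
   at the height of a pole, that term is 2 K / (x + eta), which is at least K / x once x >= eta. *)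
pose (h := fun s => (RtoC c1 * (RtoC (2 * R0) * s - s * s)
  + RtoC (2 * K) * (/ (s + (eta, (- R0)%R)) + / (s + (eta, R0))))%C).
pose (T := fun x y : R => (x + eta) / ((x + eta) ^ 2 + y ^ 2)).
assert (Hh : forall x y, Re (h (x, y)) =
  c1 * (2 * R0 * x - x ^ 2 + y ^ 2) + 2 * K * (T x (y + - R0) + T x (y + R0))).
{ intros x y. unfold h, T, Re. simpl. ring. }
assert (HT : forall x y, 0 <= x -> 0 <= T x y).
{ intros x y Hx. unfold T. assert (K1 := pow2_ge_0 y).
  assert (K2 : 0 < (x + eta) ^ 2) by (apply pow_lt; lra).
  apply Rmult_le_pos; [lra|apply Rlt_le, Rinv_0_lt_compat; lra]. }
assert (Hhd : forall s, C0bar s -> Cderivable h s).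
{ intros s Hs. unfold C0bar in Hs. apply derivable_C_plus.
  - apply derivable_C_scal, derivable_C_minus; [|apply derivable_C_square].
    apply derivable_C_scal, derivable_C_id.
  - apply derivable_C_scal, derivable_C_plus; apply derivable_C_inv;
      try (apply derivable_C_plus; [apply derivable_C_id|apply derivable_C_const]);
      destruct s; intros E; apply (f_equal fst) in E; unfold Re in Hs; simpl in *; lra. }
assert (HReminus : forall z w : C, Re (z - w) = Re z - Re w) by (intros [] []; reflexivity).
assert (Hm : Re (g (x0, y0) - h (x0, y0)) <= eps).
{ apply (max_principle_C0 (fun s => g s - h s)%C 0 R0 (- R0) R0 eps); try lra.
  - intros s Hs. apply derivable_C_minus; auto. apply Hhd. unfold C0, C0bar in *; lra.
  - intros s Hs _. apply continuous_on_C0bar_minus; [apply Hcont, Hs|].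
    apply derivable_continuous_on_C0bar, Hhd, Hs.
  - intros x y Hx Hy Hb. rewrite HReminus, Hh.
    assert (T1 := HT x (y + - R0) (proj1 Hx)). assert (T2 := HT x (y + R0) (proj1 Hx)).
    assert (Hq : 0 <= 2 * R0 * x - x ^ 2) by nra.
    assert (Hy0 := pow2_ge_0 y).
    assert (Q1 : 0 <= c1 * (2 * R0 * x - x ^ 2 + y ^ 2)) by (apply Rmult_le_pos; lra).
    assert (Q2 : 0 <= 2 * K * T x (y + - R0)) by (apply Rmult_le_pos; lra).
    assert (Q3 : 0 <= 2 * K * T x (y + R0)) by (apply Rmult_le_pos; lra).
    destruct (Req_dec x 0) as [->|Hx0n]; [specialize (H0 y); lra|].
    assert (Hgr := Hgrow (x, y) ltac:(unfold C0, Re; simpl; lra)).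
    change (Re (x, y)) with x in Hgr.
    destruct Hb as [[Hb|Hb]|Hb]; [lra| |].
    + subst x.
      assert (Q4 : c1 * R0 ^ 2 <= c1 * (2 * R0 * R0 - R0 ^ 2 + y ^ 2))
        by (apply Rmult_le_compat_l; lra).
      assert (K / R0 <= K).
      { apply Rle_div_l; [lra|]. rewrite <- (Rmult_1_r K) at 1. apply Rmult_le_compat_l; lra. }
      lra.
    + assert (Ey : y ^ 2 = R0 ^ 2) by (destruct Hb; subst y; ring).
      assert (Q4 : c1 * R0 ^ 2 <= c1 * (2 * R0 * x - x ^ 2 + y ^ 2))
        by (apply Rmult_le_compat_l; lra).
      destruct (Rle_dec x eta) as [Hxe|Hxe].
      * assert (Re (g (x, y)) <= eps) by (destruct Hb; subst y; [apply HC2|apply HC1]; lra). lra.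
      * assert (Q5 : K / x <= 2 * K * / (x + eta)).
        { apply Rle_div_l; [lra|].
          replace (2 * K * / (x + eta) * x) with (K * (2 * x) / (x + eta)) by (field; lra).
          apply Rle_div_r; [lra|]. apply Rmult_le_compat_l; lra. }
        assert (ET : T x 0 = / (x + eta)) by (unfold T; field; lra).
        destruct Hb; subst y.
        -- replace (- R0 + R0) with 0 in * by ring. rewrite ET in *. lra.
        -- replace (R0 + - R0) with 0 in * by ring. rewrite ET in *. lra. }
rewrite HReminus, Hh in Hm.
assert (HTs : forall y, R0 / 2 <= Rabs y -> T x0 y <= 4 * (x0 + 1) / R0).
{ intros y Hy. unfold T.
  assert (K1 : (R0 / 2) ^ 2 <= y ^ 2) by (rewrite <- (pow2_abs y); apply pow_incr; lra).
  assert (K2 := pow2_ge_0 (x0 + eta)).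
  apply Rle_trans with ((x0 + 1) * / (R0 / 4)).
  - apply Rmult_le_compat; [lra| |lra|].
    + apply Rlt_le, Rinv_0_lt_compat. nra.
    + apply Rinv_le_contravar; nra.
  - right. field. lra. }
assert (TT1 := HTs (y0 + - R0) ltac:(rewrite Rabs_left1; lra)).
assert (TT2 := HTs (y0 + R0) ltac:(rewrite Rabs_pos_eq; lra)).
assert (TT : 2 * K * (T x0 (y0 + - R0) + T x0 (y0 + R0)) <= 2 * K * (8 * (x0 + 1) / R0))
  by (apply Rmult_le_compat_l; lra).
assert (TC : c1 * (2 * R0 * x0 - x0 ^ 2 + y0 ^ 2) <= (M + K) * (Rabs y0 + 2 * x0) / R0).
{ replace ((M + K) * (Rabs y0 + 2 * x0) / R0)
    with (c1 * ((Rabs y0 + 2 * x0) * R0)) by (rewrite <- Ec1; field; lra).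
  apply Rmult_le_compat_l; auto. rewrite <- (pow2_abs y0). nra. }
assert (HAR : A / R0 < eps) by (apply Rlt_div_l; lra).
assert (EA : A / R0 = (M + K) * (Rabs y0 + 2 * x0) / R0 + 2 * K * (8 * (x0 + 1) / R0))
  by (unfold A; field; lra).
unfold eps in *. lra.
Qed.

(** * Dirichlet series *)

Lemma is_series_term_bounded (a : nat -> C) (l : C) :
  @is_series C_AbsRing C_NormedModule a l -> exists B, forall n, Cmod (a n) <= B.
Proof.
intros H. destruct (filterlim_bounded _ (ex_intro _ l H)) as [B HB].
assert (HB' : forall n, Cmod (@sum_n C_NormedModule a n) <= B) by exact HB.
exists (2 * B). intros [|n].
- assert (K := HB' 0%nat). rewrite sum_O in K. assert (0 <= Cmod (a 0%nat)) by apply Cmod_ge_0. lra.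
- assert (K1 := HB' n). assert (K2 := HB' (S n)).
  replace (a (S n)) with (@sum_n C_NormedModule a (S n) + - @sum_n C_NormedModule a n)%C.
  + eapply Rle_trans; [apply Cmod_triangle|]. rewrite Cmod_opp. lra.
  + rewrite sum_Sn. change plus with Cplus. ring.
Qed.

(** Telescoping: 1 / (x + 1)^2 <= 1 / x - 1 / (x + 1) keeps the sums of inverse squares below 2. *)
Lemma is_series_bound_inv_squares (a : nat -> C) (l : C) (B : R) :
  (forall n, Cmod (a n) <= B * / INR (S n) ^ 2) ->
  @is_series C_AbsRing C_NormedModule a l -> Cmod l <= 2 * B.
Proof.
intros Ha Hl.
assert (HB : 0 <= B).
{ assert (K := Ha 0%nat). assert (K1 := Cmod_ge_0 (a 0%nat)). simpl in K. lra. }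
assert (Hs : forall n, Cmod (@sum_n C_NormedModule a n) <= B * (2 - / INR (S n))).
{ induction n as [|n IHn].
  - rewrite sum_O. eapply Rle_trans; [apply Ha|]. simpl. lra.
  - rewrite sum_Sn. eapply Rle_trans; [apply Cmod_triangle|].
    eapply Rle_trans; [apply Rplus_le_compat; [apply IHn|apply Ha]|].
    rewrite <- Rmult_plus_distr_l. apply Rmult_le_compat_l; auto.
    assert (Hp : 0 < INR (S n)) by (apply lt_0_INR; lia).
    rewrite (S_INR (S n)). set (x := INR (S n)) in *.
    assert (/ (x + 1) ^ 2 <= / x - / (x + 1)).
    { replace (/ x - / (x + 1)) with (/ (x * (x + 1))) by (field; lra).
      apply Rinv_le_contravar; nra. }
    lra. }
apply (is_lim_seq_le (fun n => Cmod (@sum_n C_NormedModule a n)) (fun _ => 2 * B) (Cmod l) (2 * B)).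
- intros n. eapply Rle_trans; [apply Hs|].
  assert (0 < / INR (S n)) by (apply Rinv_0_lt_compat, lt_0_INR; lia). nra.
- apply (filterlim_comp _ _ _ (@sum_n C_NormedModule a) (@norm C_AbsRing C_NormedModule) _
    (locally (l : C_NormedModule))); [exact Hl|exact (@filterlim_norm C_AbsRing C_NormedModule l)].
- apply is_lim_seq_const.
Qed.

Lemma exp_le_compat (x y : R) : x <= y -> exp x <= exp y.
Proof. intros [H| ->]; [apply Rlt_le, exp_increasing, H|apply Rle_refl]. Qed.

Lemma Cmod_npow_neg (n : nat) (s : C) : Cmod (npow_neg n s) = exp (- Re s * ln (INR n)).
Proof.
unfold npow_neg, Cmod. simpl.
set (E := exp (- Re s * ln (INR n))). set (t := Im s * ln (INR n)).
assert (K := sin2_cos2 t). unfold Rsqr in K.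
replace (E * cos t * (E * cos t * 1) + - (E * sin t) * (- (E * sin t) * 1)) with (E * E) by nra.
apply sqrt_square, Rlt_le, exp_pos.
Qed.

(** Convergence at the single point sigma0 + 1 bounds the terms there; moving two units further
    right gains a factor n^{-2}, summable uniformly in s. The maximum with 1 keeps [sigma]
    positive. *)
Lemma dirichlet_series_bounded (c : nat -> C) (g : C -> C) (sigma0 : R) :
  (forall s, sigma0 < Re s -> is_series (dir_term c s) (g s)) ->
  exists sigma B, 0 < sigma /\ forall s, sigma <= Re s -> Cmod (g s) <= B.
Proof.
intros H.
destruct (is_series_term_bounded _ _ (H (sigma0 + 1, 0) ltac:(simpl; lra))) as [B HB].
exists (Rmax 1 (sigma0 + 3)), (2 * B). split; [apply Rlt_le_trans with (2 := Rmax_l _ _); lra|].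
intros s Hs. assert (M := Rmax_r 1 (sigma0 + 3)).
apply (is_series_bound_inv_squares (dir_term c s)); [|apply H; lra].
intros n. specialize (HB n). unfold dir_term in *. rewrite Cmod_mult, Cmod_npow_neg in *.
change (Re (sigma0 + 1, 0)) with (sigma0 + 1) in HB.
assert (Hn : 1 <= INR (S n)) by (rewrite S_INR; assert (K := pos_INR n); lra).
set (x := INR (S n)) in *.
assert (Hln : 0 <= ln x) by (rewrite <- ln_1; apply ln_le; lra).
assert (E2 : / x ^ 2 = exp (- (2 * ln x))).
{ rewrite exp_Ropp. f_equal. replace (2 * ln x) with (ln x + ln x) by ring.
  rewrite exp_plus, exp_ln by lra. ring. }
rewrite E2. apply Rle_trans with (Cmod (c n) * (exp (- (sigma0 + 1) * ln x) * exp (- (2 * ln x)))).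
- apply Rmult_le_compat_l; [apply Cmod_ge_0|]. rewrite <- exp_plus.
  apply exp_le_compat.
  assert ((sigma0 + 3) * ln x <= Re s * ln x) by (apply Rmult_le_compat_r; lra). lra.
- rewrite <- Rmult_assoc. apply Rmult_le_compat_r; [apply Rlt_le, exp_pos|auto].
Qed.

(** * Rigidity of a vanishing real part, and the conclusion *)

(** Cauchy-Riemann makes both partial derivatives of Im f vanish; a horizontal and then a vertical
    segment lead to the point 1. *)
Lemma real_part_zero_constant (f : C -> C) :
  (forall s, C0 s -> Cderivable f s) -> (forall s, C0 s -> Re (f s) = 0) ->
  forall s, C0 s -> f s = f (1, 0).
Proof.
intros Hf H0.
assert (Hd : forall x y, 0 < x -> is_derive (fun z => Im (f (z, y))) x 0 /\
  is_derive (fun z => Im (f (x, z))) y 0).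
{ intros x y Hx. destruct (derivable_C_pair f x y (Hf (x, y) Hx)) as (p & q & Hu & Hv).
  assert (Hp : p = 0 /\ q = 0).
  { assert (H2 : locally_2d (fun x y => Re (f (x, y)) = 0) x y).
    { apply (locally_2d_open_box 0 (x + 1) (y - 1) (y + 1)); try lra.
      intros x' y' Hx' _. apply (H0 (x', y')), Hx'. }
    assert (Hz := differentiable_pt_lim_ext _ (fun _ _ => 0) x y p (- q) H2 Hu).
    apply differentiable_pt_lim_unique in Hz. rewrite !Derive_const in Hz. lra. }
  destruct Hp; subst p q. split.
  - apply differentiable_derive_l with (1 := Hv).
  - apply differentiable_derive_r with (1 := Hv). }
intros [x y] Hx. unfold C0, Re in Hx; simpl in Hx.
assert (E1 : Im (f (x, y)) = Im (f (1, y))).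
{ destruct (Rtotal_order x 1) as [K|[K|K]].
  - apply (eq_is_derive (fun z => Im (f (z, y)))); auto. intros t Ht.
    exact (proj1 (Hd t y ltac:(lra))).
  - subst; auto.
  - symmetry. apply (eq_is_derive (fun z => Im (f (z, y)))); auto. intros t Ht.
    exact (proj1 (Hd t y ltac:(lra))). }
assert (E2 : Im (f (1, y)) = Im (f (1, 0))).
{ destruct (Rtotal_order y 0) as [K|[K|K]].
  - apply (eq_is_derive (fun z => Im (f (1, z)))); auto. intros t Ht.
    exact (proj2 (Hd 1 t ltac:(lra))).
  - subst; auto.
  - symmetry. apply (eq_is_derive (fun z => Im (f (1, z)))); auto. intros t Ht.
    exact (proj2 (Hd 1 t ltac:(lra))). }
assert (R1 := H0 (x, y) Hx). assert (R2 := H0 (1, 0) Rlt_0_1).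
destruct (f (x, y)), (f (1, 0)). unfold Re, Im in *. simpl in *. f_equal; lra.
Qed.

Theorem theorem24 (phi varphi : C -> C) (c0 : nat) :
  holo_C0 phi ->
  (forall s, C0 s -> C0 (phi s)) ->
  (exists s1 s2, C0 s1 /\ C0 s2 /\ phi s1 <> phi s2) ->
  in_D varphi ->
  (forall s, C0 s -> phi s = Cplus (Cmult (RtoC (INR c0)) s) (varphi s)) ->
  comp_maps_Aplus phi ->
  (forall s, C0bar s ->
     filterlim phi (within C0bar (locally s)) (locally (phi s))) ->
  (forall t : R, Re (phi (0, t)) = 0) ->
  exists tau : R, forall s, C0 s ->
    phi s = Cplus (Cmult (RtoC (INR c0)) s) (0, tau).
Proof.
intros Hphi Hpos _ [_ (a & sigma0 & Ha)] Hdec _ Hcont Hbd.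
assert (Hc := pos_INR c0). set (c := INR c0) in *.
destruct (dirichlet_series_bounded a varphi sigma0 Ha) as (sigma & B & Hsig & HB).
assert (HReminus : forall z w : C, Re (z - w) = Re z - Re w) by (intros [] []; reflexivity).
assert (HB0 : 0 <= B) by (apply Rle_trans with (2 := HB (sigma, 0) (Rle_refl _)), Cmod_ge_0).
(* Adding 1 turns Re phi > 0 into the lower bound 1 that keeps the inverse under control. *)
destruct (harnack_near_boundary (fun s => phi s + 1)%C c sigma (B + 1)) as (K & HK & HKb); auto.
{ intros s Hs. apply derivable_C_plus; [apply Hphi, Hs|apply derivable_C_const]. }
{ intros s Hs. specialize (Hpos s Hs). unfold C0 in Hpos. destruct (phi s); unfold Re in *; simpl in *; lra. }
{ intros s Hs. rewrite Hdec by (unfold C0; lra).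
  replace (c * s + varphi s + 1 - c * s)%C with (varphi s + 1)%C by ring.
  eapply Rle_trans; [apply Cmod_triangle|]. rewrite Cmod_1. specialize (HB s ltac:(lra)). lra. }
pose (g := fun s => (phi s - RtoC c * s)%C).
assert (Hgd : forall s, C0 s -> Cderivable g s).
{ intros s Hs. apply derivable_C_minus; [apply Hphi, Hs|]. apply derivable_C_scal, derivable_C_id. }
assert (Hgc : forall s, C0bar s -> continuous_on_C0bar_at g s).
{ intros s Hs. apply continuous_on_C0bar_minus.
  - apply filterlim_continuous_on_C0bar, Hcont, Hs.
  - apply derivable_continuous_on_C0bar, derivable_C_scal, derivable_C_id. }
assert (HgE : forall s, Re (g s) = Re (phi s) - c * Re s).
{ intros s. unfold g. rewrite HReminus. destruct s; unfold Re; simpl; ring. }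
assert (Hgb : forall s, sigma <= Re s -> Rabs (Re (g s)) <= B).
{ intros s Hs. apply Rle_trans with (2 := HB s Hs). replace (g s) with (varphi s).
  - apply re_le_Cmod.
  - unfold g. rewrite Hdec by (unfold C0; lra). ring. }
assert (Hle : forall s, C0 s -> Re (g s) <= 0).
{ apply (phragmen_lindelof_half_plane g B K); auto.
  - intros y. rewrite HgE, Hbd. unfold Re; simpl. lra.
  - intros s Hs. unfold C0 in Hs. destruct (Rle_dec (Re s) sigma) as [Hss|Hss].
    + specialize (HKb s ltac:(lra)). rewrite HgE.
      assert (E : Re (phi s + 1) = Re (phi s) + 1) by (destruct (phi s); reflexivity).
      rewrite E in HKb. assert (0 <= c * Re s) by (apply Rmult_le_pos; lra). lra.
    + assert (Q := Hgb s ltac:(lra)). apply Rabs_le_between in Q.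
      assert (0 <= K / Re s) by (apply Rmult_le_pos; [lra|apply Rlt_le, Rinv_0_lt_compat; lra]).
      lra. }
assert (Hopp : forall s, Re (RtoC 0 - g s) = - Re (g s)) by (intros s; rewrite HReminus; simpl; ring).
assert (Hge : forall s, C0 s -> Re (RtoC 0 - g s) <= 0).
(* No singular term here: on the strip - Re g = c Re s - Re phi < c sigma by positivity, and beyond
   it the bound [B] applies. *)
{ apply (phragmen_lindelof_half_plane (fun s => RtoC 0 - g s)%C (B + c * sigma) 0); try lra.
  - apply Rplus_le_le_0_compat; [auto|apply Rmult_le_pos; lra].
  - intros s Hs. apply derivable_C_minus; [apply derivable_C_const|apply Hgd, Hs].
  - intros s Hs. apply continuous_on_C0bar_minus; [|apply Hgc, Hs].
    apply derivable_continuous_on_C0bar, derivable_C_const.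
  - intros y. rewrite Hopp, HgE, Hbd. unfold Re; simpl. lra.
  - intros s Hs. rewrite Hopp. unfold Rdiv. rewrite Rmult_0_l, Rplus_0_r.
    assert (0 <= c * sigma) by (apply Rmult_le_pos; lra).
    destruct (Rle_dec (Re s) sigma) as [Hss|Hss].
    + rewrite HgE. specialize (Hpos s Hs). unfold C0 in *.
      assert (c * Re s <= c * sigma) by (apply Rmult_le_compat_l; lra). lra.
    + assert (Q := Hgb s ltac:(lra)). apply Rabs_le_between in Q. lra. }
assert (Hz : forall s, C0 s -> Re (g s) = 0).
{ intros s Hs. specialize (Hle s Hs). specialize (Hge s Hs). rewrite Hopp in Hge. lra. }
exists (Im (g (1, 0))). intros s Hs.
assert (E := real_part_zero_constant g Hgd Hz s Hs).
assert (E1 := Hz (1, 0) Rlt_0_1).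
replace (0, Im (g (1, 0))) with (g (1, 0)).
- rewrite <- E. unfold g. ring.
- destruct (g (1, 0)); unfold Re, Im in *; simpl in *; subst; reflexivity.
Qed.
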